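(* Let $C_A,D_R>0$. There exists a constant $C$ that may depend only on $D_R$ and $C_A$ such that, for every $P\in\mathcal P_{\mathrm{lin}}=\mathcal P_{\mathrm{lin}}(C_A,D_R)$, every $\varnothing\ne\kappa\subset\mathcal S_P$ and every $\eta\in(0,1)$, $$\mathbb P_P\Big(\forall k\in\kappa:\ |\widehat\omega_k-\omega_k|<r_k(\eta)\Big)\ge1-\eta,$$ where $$r_k(\eta)=\Big\lceil C\log\Big(\frac{e|\kappa|}{\eta}\Big)\big(\nu_k^{-2}+\nu_k^{-1}\big)\Big\rceil .$$
   Context: Notation: $[N]=\{1,\dots,N\}$. For real $X$, $\|X\|_{\psi_1}=\inf\{B>0:\mathbb E[\exp(|X|/B)-1]\le1\}$; $\|\cdot\|_{\mathrm{op}}$ is the operator norm. Model. The sample size $n$ and the number of coordinates $K$ are arbitrary positive integers (with $n\ge2$), $\mathbb H_1,\dots,\mathbb H_K$ are separable (real) Hilbert spaces, $\mathcal H=\bigoplus_{k\in[K]}\mathbb H_k$. Observations are, for $i\in[n]$, $k\in[K]$, $$f_k^{(i)}=\mu_k+\delta_k\mathbf 1\{i>\omega_k\}+\varepsilon_k^{(i)},\qquad\mu_k,\delta_k\in\mathbb H_k,\ \omega_k\in[n-1],$$ where $(\varepsilon^{(i)})_{i\in\mathbb Z}$, $\varepsilon^{(i)}=(\varepsilon_1^{(i)},\dots,\varepsilon_K^{(i)})\in\mathcal H$, is a centered strictly stationary noise process. Assumption [B] (with constants $C_A,D_R$): for every $k\in[K]$, $\varepsilon_k^{(i)}=\sum_{j=0}^\infty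 A_{k,j}\eta_k^{(i-j)}$, $i\in\mathbb Z$, where each $A_{k,j}:\mathbb H_k\to\mathbb H_k$ is a bounded linear operator, $\max_{k\in[K]}\sum_{j=0}^\infty(j+1)\|A_{k,j}\|_{\mathrm{op}}\le C_A$, and $(\eta^{(i)})_{i\in\mathbb Z}$, $\eta^{(i)}=(\eta_1^{(i)},\dots,\eta_K^{(i)})\in\mathcal H$, is a centered i.i.d. sequence with $\max_{k\in[K]}\big\|\|\eta_k^{(0)}\|_{\mathbb H_k}\big\|_{\psi_1}\le D_R$. (The innovations $\eta^{(i)}$ are unrelated to the confidence level $\eta$.) $\mathcal P_{\mathrm{lin}}(C_A,D_R)$ is the class of data-generating distributions satisfying the model with noise fulfilling [B] with these constants. For $P$: $\mathcal S_P=\{k\in[K]:\delta_k\ne0\}$; for $k\in\mathcal S_P$: $\theta_k=\omega_k/n$, $\gamma_k=\min(\theta_k,1-\theta_k)$, $\Delta_k=\|\delta_k\|_{\mathbb H_k}$, $\nu_k=\gamma_k\Delta_k$. Estimator. $C_{n,k}(s)=n^{-1/2}\sum_{i=1}^s(f_k^{(i)}-\bar f_k)$ with $\bar f_k=n^{-1}\sum_{i=1}^nf_k^{(i)}$; $\widehat\omega_k$ is the smallest $s\in[n]$ with $\|C_{n,k}(s)\|_{\mathbb H_k}^2=\max_{t\in[n]}\|C_{n,k}(t)\|_{\mathbb H_k}^2$. *)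

(* Defs.v *)
From HB Require Import structures.
From mathcomp Require Import all_boot all_order all_algebra.
From mathcomp Require Import all_classical all_reals all_analysis.

Set Implicit Arguments.
Unset Strict Implicit.
Unset Printing Implicit Defensive.

Import Order.TTheory GRing.Theory Num.Theory.
Import numFieldNormedType.Exports.

Local Open Scope classical_set_scope.
Local Open Scope ring_scope.

(* The norm, topology and completeness are those of completeNormedModType; the
   mixin adds the real inner product inducing that norm. *)
HB.mixin Record CompleteNormedModule_isHilbert (R : realType) V
    of CompleteNormedModule R V := {
  hdot : {dot V for idfun} ;
  hdot_norm : forall x : V, hdot x x = `|x| ^+ 2
}.

#[short(type="hilbertType")]
HB.structure Definition Hilbert (R : realType) :=
  { V of CompleteNormedModule R V & CompleteNormedModule_isHilbert R V }.

Definition separable (T : topologicalType) : Prop :=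
  exists2 S : set T, countable S & dense S.

Definition borel (T : topologicalType) : set (set T) := <<s @open T >>.

Section RandomElements.
Context (d : measure_display) (Om : measurableType d) (R : realType) (P : probability Om R).

Definition random_element (T : topologicalType) (X : Om -> T) : Prop :=
  forall B : set T, borel B -> measurable (X @^-1` B).

Definition same_law (T : topologicalType) (X Y : Om -> T) : Prop :=
  forall B : set T, borel B -> P (X @^-1` B) = P (Y @^-1` B).

Definition independent (I : choiceType) (T : topologicalType)
    (X : I -> Om -> T) : Prop :=
  forall (s : seq I) (B : I -> set T), uniq s -> (forall i, borel (B i)) ->
    P (\bigcap_(i in [set` s]) (X i @^-1` B i)) =
    (\prod_(i <- s) P (X i @^-1` B i))%E.

Definition iid (T : topologicalType) (X : int -> Om -> T) : Prop :=
  independent X /\ forall i j, same_law (X i) (X j).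

(* The joint law of (X_(t 0 + h), ..., X_(t (m - 1) + h)) on T^m does not
   depend on the shift h. *)
Definition strictly_stationary (T : topologicalType) (X : int -> Om -> T)
    : Prop :=
  forall (m : nat) (t : 'I_m -> int) (h : int),
    @same_law (prod_topology (fun _ : 'I_m => T))
      (fun w j => X (t j + h) w) (fun w j => X (t j) w).

(* E X = 0, where the mean of X with E|X| < oo is the vector m such that
   <m, v> = E <X, v> for all v. *)
Definition centered (V : hilbertType R) (X : Om -> V) : Prop :=
  P.-integrable setT (fun w => (`|X w|)%:E) /\
  forall v : V, ('E_P[(fun w => hdot (X w) v)] = 0)%E.

(* Equal to +oo when no B qualifies. *)
Definition psi1_norm (X : Om -> R) : \bar R :=
  ereal_inf [set B%:E | B in
    [set B : R | 0 < B /\ ('E_P[(fun w => expR (`|X w| / B) - 1)%R] <= 1)%E]].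

End RandomElements.

Definition op_norm (R : realType) (V W : normedModType R) (A : V -> W)
    : \bar R :=
  ereal_sup [set (`|A x|)%:E | x in [set x : V | `|x| <= 1]].

Definition bounded_operator (R : realType) (V W : normedModType R)
    (A : V -> W) : Prop :=
  exists M : R, forall x, `|A x| <= M * `|x|.

(* The finite direct sum of Hilbert spaces as a topological space: its norm
   (\sum_k |x k|^2)^(1/2) induces the product topology. *)
Definition dsum (R : realType) (K : nat) (H : 'I_K -> hilbertType R) :=
  prod_topology (fun k => H k : topologicalType).

Section Model.
Context (d : measure_display) (Om : measurableType d) (R : realType) (P : probability Om R).
Context (K : nat) (H : 'I_K -> hilbertType R).

Definition stationary_noise (eps : int -> Om -> dsum H) : Prop :=
  [/\ forall i, random_element (eps i),
      forall i k, centered P (fun w => eps i w k) &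
      strictly_stationary P eps].

Definition assumption_B (CA DR : R) (eps : int -> Om -> dsum H) : Prop :=
  exists (A : forall k, nat -> {linear H k -> H k}) (eta : int -> Om -> dsum H),
  [/\ (forall k j, bounded_operator (A k j)) /\
      (forall k, \sum_(0 <= j <oo) (j.+1%:R%:E * op_norm (A k j)) <= CA%:E)%E,
      (forall i, random_element (eta i)) /\ iid P eta,
      forall i k, centered P (fun w => eta i w k),
      forall k, (psi1_norm P (fun w => `|eta 0 w k|)%R <= DR%:E)%E &
      forall k i, {ae P, forall w,
        (fun N => \sum_(0 <= j < N) A k j (eta (i - j%:Z) w k)) @ \oo
          --> (eps i w k : H k)}].

Definition observation (mu delta : forall k, H k) (omega : 'I_K -> nat)
    (eps : int -> Om -> dsum H) (k : 'I_K) (w : Om) (i : nat) : H k :=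
  mu k + (omega k < i)%N%:R *: delta k + eps i%:Z w k.

End Model.

Section Estimator.
Context (R : realType) (V : normedModType R) (n : nat).

Definition sample_mean (f : nat -> V) : V :=
  n%:R^-1 *: \sum_(1 <= i < n.+1) f i.

Definition cusum (f : nat -> V) (s : nat) : V :=
  (Num.sqrt n%:R)^-1 *: \sum_(1 <= i < s.+1) (f i - sample_mean f).

(* The smallest maximizer; the list iota 1 n = [:: 1; ...; n] is increasing,
   and the bigop start value 0 is harmless since the squares are nonnegative. *)
Definition omega_hat (f : nat -> V) : nat :=
  head 0%N [seq s <- iota 1 n |
    `|cusum f s| ^+ 2 == \big[Num.max/0]_(1 <= t < n.+1) `|cusum f t| ^+ 2].

End Estimator.

Section Rates.
Context (R : realType) (K : nat) (H : 'I_K -> hilbertType R).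

Definition change_set (delta : forall k, H k) : {set 'I_K} :=
  [set k | delta k != 0]%SET.

Definition nu (n : nat) (delta : forall k, H k) (omega : 'I_K -> nat)
    (k : 'I_K) : R :=
  let theta : R := (omega k)%:R / n%:R in
  Num.min theta (1 - theta) * `|delta k|.

Definition conf_radius (n : nat) (delta : forall k, H k) (omega : 'I_K -> nat)
    (C eta : R) (kappa : {set 'I_K}) (k : 'I_K) : int :=
  Num.ceil (C * ln (expR 1 * #|kappa|%:R / eta)
              * ((nu n delta omega k) ^- 2 + (nu n delta omega k)^-1)).

End Rates.

(* Main.v *)
Require Import Defs.
From HB Require Import structures.
From mathcomp Require Import all_boot all_order all_algebra.
From mathcomp Require Import all_classical all_reals all_analysis.
From mathcomp Require Import measurable_realfun zify ring lra.
Import Order.TTheory GRing.Theory Num.Theory.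
Import numFieldNormedType.Exports.
Local Open Scope classical_set_scope.
Local Open Scope ring_scope.

Set Implicit Arguments.
Unset Strict Implicit.
Unset Printing Implicit Defensive.

(** The estimator is the maximizer of the norm of a cumulative sum process that
    splits as a tent-shaped multiple of the jump [delta k], peaking at the change
    point, plus a bridge of the noise. A point [s] at distance [m] from the
    change point can only win if the noise makes up for the drop of the tent,
    which is at least [m * nu]. So everything reduces to one statement about
    noise ([argmax_close]): with high probability the noise summed over [m]
    consecutive times, starting at the change point and going either forwards
    or backwards, has norm at most [(nu / 16) * max m rho] for all [m <= n] at
    once. This reduction uses the triangle inequality only.

    The required bound is an exponential maximal inequality for partial sums
    [S m] of independent centered vectors with exponential moments
    ([maximal_inequality]). In a Hilbert space, [cosh (l * |t + x|)] is at most
    [cosh (l * |t|) * (exp (l * |x|) - l * |x|)] plus a term linear in [x]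
    ([cosh_normD]): the square of [|t + x|] interpolates linearly between
    [(|t| - |x|) ^ 2] and [(|t| + |x|) ^ 2], and [cosh] is a convex function of
    the square of its argument. Averaging over [x] kills the linear term, so
    [cosh (l * |S m|)] grows in mean by a factor at most [1 + s ^ 2] per step,
    where [s = l * D] and [D] is the scale of the noise. Ville's inequality
    then controls [cosh (l * |S m|) / (1 + s ^ 2) ^ m] for all times [m] at
    once. Because the normalization grows with [m], a threshold linear in [m] is
    handled without splitting the times into blocks and without losing a
    logarithmic factor, which is what gives the rate [nu ^- 2 + nu^-1].

    For the linear process, the sums of the noise are combinations over the
    lags [j] of images under [A k j] of sums of innovations. Lag [j] is granted
    a threshold proportional to [j + 1]; the weighted summability of the
    operator norms says that these thresholds add up correctly, and the failure
    probabilities form a geometric series ([linear_process_maximal]). A union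
    bound over the coordinates in [kappa] and the two directions finishes the
    proof.

    Separability of the spaces makes addition jointly measurable
    ([add_borel_measurable]). Hence sums of random elements are random elements,
    and the next variable can be integrated out with the past frozen
    ([ge0_integral_independent]). *)

(** * Hyperbolic cosine inequalities *)

Section PowerSeries.
Context {R : realType}.
Implicit Types x y z : R.

Definition cosh x : R := (expR x + expR (- x)) / 2.
Definition sinh x : R := (expR x - expR (- x)) / 2.

Lemma sinh_le_cosh x : sinh x <= cosh x.
Proof. by rewrite /sinh /cosh ler_pM2r//; have := expR_ge0 (- x); lra. Qed.

Lemma cosh_ge1 x : 1 <= cosh x.
Proof.
by rewrite /cosh; have := expR_ge1Dx x; have := expR_ge1Dx (- x); lra.
Qed.

Lemma cosh_ge_half_expR x : expR x / 2 <= cosh x.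
Proof. by rewrite /cosh ler_pM2r//; have := expR_ge0 (- x); lra. Qed.

Lemma cvg_expR_series x : series (exp_coeff x) @ \oo --> expR x.
Proof. exact: is_cvg_series_exp_coeff. Qed.

(** Comparing power series termwise; the index shift leaves room for treating
    the terms of order zero and one by hand. *)
Lemma ler_cvg_series (u v : R^nat) (l m c : R) :
    series u @ \oo --> l -> series v @ \oo --> m ->
    (forall n : nat, c + series u n.+2 <= series v n.+2) -> c + l <= m.
Proof.
move=> ul vm uv; apply: (@ler_cvg_to _ \oo _ R (fun n => c + series u (n + 2)%N)
  (fun n => series v (n + 2)%N)).
- by apply: cvgD; [exact: cvg_cst|rewrite (cvg_shiftn 2 (series u))].
- by rewrite (cvg_shiftn 2 (series v)).
- by near=> n; rewrite addn2; exact: uv.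
Unshelve. all: by end_near. Qed.

Lemma cvg_cosh_series x :
  series (fun n => (x ^+ n + (- x) ^+ n) / (2 * n`!%:R)) @ \oo --> cosh x.
Proof.
have -> : series (fun n => (x ^+ n + (- x) ^+ n) / (2 * n`!%:R)) =
    (fun n => (series (exp_coeff x) n + series (exp_coeff (- x)) n) / 2).
  apply/funext => n; rewrite /series/= -big_split/= mulr_suml.
  apply: eq_bigr => i _; rewrite /exp_coeff/=.
  by rewrite invfM mulrA -mulrDl mulrAC.
by apply: cvgM; [apply: cvgD; exact: cvg_expR_series|exact: cvg_cst].
Qed.

Lemma cvg_sinh_series x :
  series (fun n => (x ^+ n - (- x) ^+ n) / (2 * n`!%:R)) @ \oo --> sinh x.
Proof.
have -> : series (fun n => (x ^+ n - (- x) ^+ n) / (2 * n`!%:R)) =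
    (fun n => (series (exp_coeff x) n - series (exp_coeff (- x)) n) / 2).
  apply/funext => n; rewrite /series/= -sumrB mulr_suml.
  apply: eq_bigr => i _; rewrite /exp_coeff/=.
  by rewrite invfM mulrA -mulrBl mulrAC.
by apply: cvgM; [apply: cvgB; exact: cvg_expR_series|exact: cvg_cst].
Qed.

Lemma sinh_ge x : 0 <= x -> x <= sinh x.
Proof.
move=> x0; rewrite -[leLHS]addr0.
apply: (ler_cvg_series (u := fun=> 0) _ (@cvg_sinh_series x)).
  rewrite (_ : series _ = fun=> 0); first exact: cvg_cst.
  by apply/funext => n; rewrite /series/= big1.
move=> n; rewrite /series/= big1_eq addr0 2?big_nat_recl//.
rewrite !expr0 subrr mul0r add0r !expr1.
rewrite (_ : (x - - x) / (2 * _) = x); last by rewrite (_ : 1`! = 1)%N//; field.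
rewrite lerDl sumr_ge0// => i _; rewrite divr_ge0//.
by rewrite exprNn -signr_odd; case: odd; rewrite ?expr1 ?expr0;
  have := exprn_ge0 i.+2 x0; lra.
Qed.

(** When the argument is scaled down by [s], each term of order at least two of
    the exponential series shrinks at least by [s ^+ 2]. *)
Lemma expR_scale s x : 0 <= s <= 1 -> 0 <= x ->
  expR (s * x) - s * x - 1 <= s ^+ 2 * (expR x - x - 1).
Proof.
move=> /andP[s0 s1] x0.
suff : (s ^+ 2 - 1) + ((s ^+ 2 - s) * x) + expR (s * x) <= s ^+ 2 * expR x.
  by rewrite !mulrBr mulr1 mulrBl; lra.
apply: (ler_cvg_series (@cvg_expR_series (s * x))
  (v := fun n => s ^+ 2 * exp_coeff x n)).
  rewrite (_ : series _ = fun n => s ^+ 2 * series (exp_coeff x) n).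
    by apply: cvgM; [exact: cvg_cst|exact: cvg_expR_series].
  by apply/funext => n; rewrite /series/= mulr_sumr.
move=> n; rewrite /series/= !big_nat_recl//.
rewrite /exp_coeff/= !expr0 !expr1 (_ : 0`!%N = 1%N)// (_ : 1`!%N = 1%N)// !divr1.
rewrite !addrA (_ : _ + s * x = s ^+ 2 * 1 + s ^+ 2 * x); last by ring.
rewrite lerD2l; apply: ler_sum => i _.
rewrite mulrA ler_pM2r ?invr_gt0 ?ltr0n ?fact_gt0// exprMn ler_wpM2r ?exprn_ge0// -addn2 exprD.
by rewrite ler_piMl ?exprn_ge0// exprn_ile1.
Qed.

Lemma ler_exprn_conv a b (t : R) n : 0 <= a -> 0 <= b -> 0 <= t <= 1 ->
  (t * a + (1 - t) * b) ^+ n <= t * a ^+ n + (1 - t) * b ^+ n.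
Proof.
move=> a0 b0 /andP[t0 t1]; have t1' : 0 <= 1 - t by rewrite subr_ge0.
have c0 : 0 <= t * a + (1 - t) * b by rewrite addr_ge0// mulr_ge0.
elim: n => [|n IH]; first by rewrite !expr0; lra.
rewrite exprSr (le_trans (ler_wpM2r c0 IH))// -subr_ge0.
rewrite (_ : _ - _ = (t * (1 - t)) * ((a ^+ n - b ^+ n) * (a - b))); last first.
  by rewrite !exprSr; ring.
rewrite mulr_ge0 ?(mulr_ge0 t0)//; case: (leP a b) => ab.
  by rewrite mulr_le0 ?subr_le0 ?lerXn2r.
by rewrite mulr_ge0// subr_ge0 ?lerXn2r// ltW.
Qed.

Lemma expr_sym z n :
  z ^+ n + (- z) ^+ n = if odd n then 0 else 2 * (z ^+ 2) ^+ n./2.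
Proof.
rewrite exprNn -signr_odd; case: ifP => on; rewrite ?expr1 ?expr0.
  by rewrite mulN1r subrr.
by rewrite -exprM mul2n -{1 2}(odd_double_half n) on add0n; ring.
Qed.

(** As a function of [x ^+ 2], the hyperbolic cosine is a power series with
    nonnegative coefficients, hence convex. *)
Lemma cosh_sqr_convex a b z (t : R) : 0 <= t <= 1 ->
  z ^+ 2 = t * a ^+ 2 + (1 - t) * b ^+ 2 ->
  cosh z <= t * cosh a + (1 - t) * cosh b.
Proof.
move=> t01 zE; rewrite -[cosh z]add0r.
apply: (ler_cvg_series (@cvg_cosh_series z) (v := fun n =>
  t * ((a ^+ n + (- a) ^+ n) / (2 * n`!%:R))
  + (1 - t) * ((b ^+ n + (- b) ^+ n) / (2 * n`!%:R)))).
  rewrite (_ : series _ = fun n =>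
    t * series (fun n => (a ^+ n + (- a) ^+ n) / (2 * n`!%:R)) n
    + (1 - t) * series (fun n => (b ^+ n + (- b) ^+ n) / (2 * n`!%:R)) n).
    by apply: cvgD; (apply: cvgM; [exact: cvg_cst|exact: cvg_cosh_series]).
  by apply/funext => n; rewrite /series/= !mulr_sumr -big_split.
move=> n; rewrite add0r /series/=; apply: ler_sum => i _.
rewrite !mulrA -mulrDl ler_pM2r ?invr_gt0 ?mulr_gt0 ?ltr0n ?fact_gt0//.
rewrite !expr_sym; case: ifP => _; first by rewrite !mulr0 addr0.
have := ler_exprn_conv i./2 (sqr_ge0 a) (sqr_ge0 b) t01.
by rewrite -zE; lra.
Qed.

(** Writing [c = rho * a * b], the point [a ^+ 2 + b ^+ 2 + 2 * c] is a convex
    combination of [(a + b) ^+ 2] and [(a - b) ^+ 2]; the addition formulas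
    then give [cosh z <= cosh a * cosh b + rho * sinh a * sinh b]. Replacing
    [sinh b] by [b] in the last term costs at most [cosh a * (sinh b - b)]. *)
Lemma cosh_law_of_cosines a b z rho : 0 <= a -> 0 <= b -> -1 <= rho <= 1 ->
  z ^+ 2 = a ^+ 2 + b ^+ 2 + 2 * (rho * (a * b)) ->
  cosh z <= cosh a * (expR b - b) + rho * (sinh a * b).
Proof.
move=> a0 b0 /andP[r1 r2] zE.
have t01 : 0 <= (1 + rho) / 2 <= 1 by lra.
have /le_trans-> // : cosh z <= cosh a * cosh b + rho * (sinh a * sinh b).
  have zE' : z ^+ 2 = (1 + rho) / 2 * (a + b) ^+ 2
      + (1 - (1 + rho) / 2) * (a - b) ^+ 2 by rewrite zE; field.
  rewrite (le_trans (cosh_sqr_convex t01 zE'))//.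
  rewrite /cosh /sinh !opprD opprK !expRD.
  by rewrite le_eqVlt; apply/orP; left; apply/eqP; field.
have sb : 0 <= sinh b - b by rewrite subr_ge0 sinh_ge.
have ra : rho * sinh a <= cosh a.
  rewrite (le_trans _ (sinh_le_cosh a))// ler_piMl//.
  by rewrite (le_trans a0)// sinh_ge.
rewrite -subr_ge0 (_ : _ - _ = (cosh a - rho * sinh a) * (sinh b - b)).
  by rewrite mulr_ge0// subr_ge0.
by rewrite /cosh /sinh; field.
Qed.

End PowerSeries.

(** * Borel random elements of a separable normed space *)

Local Notation borel_type V := (g_sigma_algebraType (@open V)).

Section BorelMeasurability.
Context {R : realType}.

Lemma random_elementP d (Om : measurableType d) (V : normedModType R)
    (X : Om -> V) :
  random_element X <-> measurable_fun setT (X : Om -> borel_type V).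
Proof.
split=> [mX _ B mB|mX B mB]; first by rewrite setTI; exact: mX.
by rewrite -[X in measurable X]setTI; exact: mX.
Qed.

Lemma continuous_borel_measurable (V W : normedModType R) (f : V -> W) :
  continuous f -> measurable_fun setT (f : borel_type V -> borel_type W).
Proof.
move=> /continuousP cf.
apply: (@measurability _ _ (borel_type V) (borel_type W) _ _ (@open W)) => //.
move=> _ [U oU <-]; rewrite setTI; apply: sub_sigma_algebra; exact: cf.
Qed.

Lemma norm_borel_measurable (V : normedModType R) :
  measurable_fun setT ((fun x => `|x|) : borel_type V -> R).
Proof.
apply: (@measurability _ _ (borel_type V) R _ _ (@RGenOInfty.G R)).
  exact: RGenOInfty.measurableE.
move=> _ [_ [x ->] <-]; rewrite setTI; apply: sub_sigma_algebra.
rewrite preimage_itvoy.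
have /continuousP := @norm_continuous _ V.
move=> /(_ _ (@open_gt R x)).
by congr open; apply/seteqP; split => y.
Qed.

Lemma separable_dense_seq (V : normedModType R) : separable V ->
  exists e : nat -> V, forall x (r : R), 0 < r -> exists n, `|x - e n| < r.
Proof.
move=> [S /countable_injP[f fi] dS].
exists (fun n => xget 0 [set x | S x /\ f x = n]) => x r r0.
have [|y [xy Sy]] := dS (ball x r) _ (ball_open x r).
  by exists x; exact: ballxx.
exists (f y); case: xgetP => [z _ [Sz zy]|/(_ y)]; last by case.
rewrite (_ : z = y); last by apply: fi => //; rewrite inE.
by move: xy; rewrite -ball_normE.
Qed.

(** Separability is what makes the Borel sigma-algebra of [V * V] the product
    of the Borel sigma-algebras, hence sums of random elements measurable. *)
Lemma add_borel_measurable (V : normedModType R) : separable V ->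
  measurable_fun setT
    ((fun z => z.1 + z.2) : borel_type V * borel_type V -> borel_type V).
Proof.
move=> /separable_dense_seq[e eP].
apply: (@measurability _ _ (borel_type V * borel_type V)%type (borel_type V)
  _ _ (@open V)) => // _ [U oU <-]; rewrite setTI.
pose C (a b n : nat) : set (borel_type V * borel_type V) :=
  [set z | [/\ ball (e a) n.+1%:R^-1 z.1, ball (e b) n.+1%:R^-1 z.2 &
     forall u v, ball (e a) n.+1%:R^-1 u -> ball (e b) n.+1%:R^-1 v ->
       U (u + v)]].
rewrite (_ : _ @^-1` U = \bigcup_a \bigcup_b \bigcup_n C a b n); last first.
  apply/seteqP; split=> [[u v] /= Uuv|[u v] [a _ [b _ [n _ [/= ua vb]]]]];
    last exact.
  have /nbhs_ballP[r /= r0 rU] : nbhs (u + v) U by exact: open_nbhs_nbhs.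
  have [n nr] : exists n, n.+1%:R^-1 < r / 4.
    have [n _ /(_ _ (leqnn n))] :=
      near_infty_natSinv_lt (PosNum (divr_gt0 r0 (ltr0Sn R 3))).
    by exists n.
  have n0 : 0 < n.+1%:R^-1 :> R by rewrite invr_gt0.
  have [a ua] := eP u _ n0; have [b vb] := eP v _ n0.
  exists a => //; exists b => //; exists n => //; split => /=.
  - by rewrite -ball_normE/= distrC.
  - by rewrite -ball_normE/= distrC.
  move=> u' v'; rewrite -!ball_normE/= => ua' vb'; apply: rU.
  rewrite -ball_normE/=.
  rewrite (_ : u + v - (u' + v') = (u - e a) + (e a - u') + ((v - e b) + (e b - v'))).
    rewrite (le_lt_trans (ler_normD _ _))//.
    have := ler_normD (u - e a) (e a - u').
    have := ler_normD (v - e b) (e b - v').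
    by move: ua ua' vb vb' nr; move: (n.+1%:R^-1) => q; lra.
  by rewrite !subrKA opprD addrACA.
apply: bigcup_measurable => a _; apply: bigcup_measurable => b _.
apply: bigcup_measurable => n _.
rewrite /C; set Q := forall u v, _.
have [q|nq] := pselect Q; last first.
  rewrite (_ : [set _ | _] = set0); first exact: measurable0.
  by rewrite -subset0 => z [].
rewrite (_ : [set _ | _] = ball (e a) n.+1%:R^-1 `*` ball (e b) n.+1%:R^-1).
  by apply: measurableX; apply: sub_sigma_algebra; exact: ball_open.
by apply/seteqP; split => z []//.
Qed.

Section Sums.
Context d (Om : measurableType d) (V : normedModType R).
Hypothesis sepV : separable V.
Implicit Types X Y : Om -> V.

Lemma random_elementD X Y : random_element X -> random_element Y ->
  random_element (fun w => X w + Y w).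
Proof.
move=> /random_elementP mX /random_elementP mY; apply/random_elementP.
exact: (measurableT_comp (add_borel_measurable sepV) (measurable_fun_pair mX mY)).
Qed.

Lemma random_elementZ (c : R) X : random_element X ->
  random_element (fun w => c *: X w).
Proof.
move=> /random_elementP mX; apply/random_elementP.
apply: (measurableT_comp _ mX).
by apply: continuous_borel_measurable => x; exact: scaler_continuous.
Qed.

Lemma random_element_cst (c : V) : random_element (fun _ : Om => c).
Proof. by apply/random_elementP; exact: measurable_cst. Qed.

Lemma random_element_sum (I : eqType) (s : seq I) (X : I -> Om -> V) :
  (forall i, i \in s -> random_element (X i)) ->
  random_element (fun w => \sum_(i <- s) X i w).
Proof.
elim: s => [_|i s IH mX].
  by under eq_fun do rewrite big_nil; exact: random_element_cst.
under eq_fun do rewrite big_cons.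
apply: random_elementD; first by apply: mX; rewrite mem_head.
by apply: IH => j js; apply: mX; rewrite inE js orbT.
Qed.

Lemma measurable_norm_random X : random_element X ->
  measurable_fun setT (fun w => `|X w|).
Proof.
by move=> /random_elementP; exact: measurableT_comp (@norm_borel_measurable V).
Qed.

End Sums.
End BorelMeasurability.

(** * Independence of the past and the next variable *)

Section Freezing.
Context d d1 d2 (Om : measurableType d) (T1 : measurableType d1)
  (T2 : measurableType d2) (R : realType) (P : probability Om R).

(** The pair [(I, X)] has the product of the laws of [I] and [X] as law, so this
    is Tonelli's theorem. It serves with [I] the identity into the sample space
    with the coarser sigma-algebra of the past. *)
Lemma ge0_integral_independent (I : Om -> T1) (X : Om -> T2)
    (f : T1 * T2 -> \bar R) :
  measurable_fun setT I -> measurable_fun setT X ->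
  (forall A B, measurable A -> measurable B ->
    P (I @^-1` A `&` X @^-1` B) = (P (I @^-1` A) * P (X @^-1` B))%E) ->
  measurable_fun setT f -> (forall z, 0 <= f z)%E ->
  (\int[P]_w f (I w, X w) = \int[P]_w \int[P]_w' f (I w, X w'))%E.
Proof.
move=> mI mX indep mf f0.
pose I' : {mfun Om >-> T1} := HB.pack I (isMeasurableFun.Build _ _ _ _ _ mI).
pose X' : {mfun Om >-> T2} := HB.pack X (isMeasurableFun.Build _ _ _ _ _ mX).
have mIX : measurable_fun setT (fun w => (I w, X w)) by exact: measurable_fun_pair.
pose IX : {mfun Om >-> (T1 * T2)%type} :=
  HB.pack (fun w => (I w, X w)) (isMeasurableFun.Build _ _ _ _ _ mIX).
pose mu1 := distribution P I'; pose mu2 := distribution P X'.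
pose mu := distribution P IX.
have muE : forall A, measurable A -> (mu1 \x mu2)%E A = mu A.
  by apply: product_measure_unique => A B mA mB; exact: indep.
transitivity (\int[mu]_z f z)%E; first by rewrite ge0_integral_distribution.
transitivity (\int[mu1 \x mu2]_z f z)%E.
  by apply: eq_measure_integral => A mA _; exact/esym/muE.
rewrite fubini_tonelli1// ge0_integral_distribution//.
- apply: eq_integral => w _ /=; rewrite /fubini_F ge0_integral_distribution//.
  by apply: measurableT_comp => //; exact: measurable_pair1.
- exact: measurable_fun_fubini_tonelli_F.
- by move=> x; exact: integral_ge0.
Qed.

Lemma measurable_integral_frozen (X : Om -> T2) (f : T1 * T2 -> \bar R) :
  measurable_fun setT X -> measurable_fun setT f -> (forall z, 0 <= f z)%E ->
  measurable_fun setT (fun t => (\int[P]_w f (t, X w))%E).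
Proof.
move=> mX mf f0.
apply: (@measurable_fun_fubini_tonelli_F _ _ _ _ _ P (fun z => f (z.1, X z.2))) => //.
apply: measurableT_comp mf _; apply: measurable_fun_pair => //.
exact: measurableT_comp mX measurable_snd.
Qed.

End Freezing.

Lemma borel_preimage (T U : topologicalType) (h : T -> U) (B : set U) :
  continuous h -> borel B -> borel (h @^-1` B).
Proof.
move=> /continuousP ch mB.
have : image_set_system setT h (@borel T) B; last first.
  by rewrite /image_set_system/= setTI.
move: B mB; apply: smallest_sub.
  by apply: sigma_algebra_image; exact: smallest_sigma_algebra.
move=> O oO; rewrite /image_set_system/= setTI.
by apply: sub_gen_smallest; exact: ch.
Qed.

Section Independence.
Context d (Om : measurableType d) (R : realType) (P : probability Om R).

Lemma independent_reindex (I J : choiceType) (T : topologicalType)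
    (X : J -> Om -> T) (f : I -> J) (g : J -> I) :
  cancel f g -> independent P X -> independent P (fun i => X (f i)).
Proof.
move=> fg indX s B us mB.
have := indX [seq f i | i <- s] (fun j => B (g j)).
rewrite map_inj_uniq; last exact: can_inj fg.
move=> /(_ us (fun j => mB (g j))); rewrite big_map.
under eq_bigr do rewrite fg.
move=> <-; congr (P _); apply/seteqP; split => w /= h i /=.
  by move=> /mapP[j js ->]; rewrite fg; exact: h.
by move=> js; have := h (f i) (map_f f js); rewrite fg.
Qed.

Lemma independent_comp (I : choiceType) (T U : topologicalType)
    (X : I -> Om -> T) (h : T -> U) : continuous h ->
  independent P X -> independent P (fun i w => h (X i w)).
Proof.
move=> ch indX s B us mB.
by apply: (indX s (fun i => h @^-1` B i) us) => i; exact: borel_preimage.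
Qed.

Context (T : normedModType R) (X : nat -> Om -> T).
Hypothesis mX : forall i, random_element (X i).
Hypothesis indX : independent P X.

(** A pi-system generating the sigma-algebra of the first [m] variables. *)
Definition cylinders (m : nat) : set (set Om) :=
  [set E | exists2 B : nat -> set T, (forall i, borel (B i)) &
    E = \bigcap_(i in [set` iota 0 m]) (X i @^-1` B i)].

(** Both sides are finite measures in [E] that agree on the cylinders. *)
Lemma past_independent m (E : set Om) (B : set T) :
  <<s cylinders m >> E -> borel B ->
  P (E `&` X m @^-1` B) = (P E * P (X m @^-1` B))%E.
Proof.
move=> sE mB.
have mXB : measurable (X m @^-1` B) by exact: mX.
have cylm : cylinders m `<=` measurable.
  move=> _ [B' mB' ->]; apply: fin_bigcap_measurable => // i _; exact: mX.
have scylm : <<s cylinders m >> `<=` measurable.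
  by apply: smallest_sub => //; exact: sigma_algebra_measurable.
have PB : P (X m @^-1` B) \is a fin_num by exact: fin_num_measure.
pose r := NngNum (fine_ge0 (measure_ge0 P (X m @^-1` B))).
have rE : (r%:num)%:E = P (X m @^-1` B) by rewrite fineK.
transitivity (mscale r P E); last by rewrite /mscale/= rE muleC.
transitivity (mrestr P mXB E) => //.
apply: (@g_sigma_algebra_measure_unique _ R Om (cylinders m) cylm
  (fun=> setT)) => //.
- move=> _; exists (fun=> setT) => [_|]; first exact: (@measurableT _ (borel_type T)).
  by apply/seteqP; split => // w _ i _.
- by rewrite bigcup_const//; exists 0%N.
- move=> _ _ [B1 mB1 ->] [B2 mB2 ->]; exists (fun i => B1 i `&` B2 i).
    by move=> i; exact: (@measurableI _ (borel_type T) _ _ (mB1 i) (mB2 i)).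
  by rewrite -bigcapI.
- move=> _ [B' mB' ->]; rewrite /mrestr/= /mscale/= rE.
  pose B'' i := if i == m then B else B' i.
  have mB'' i : borel (B'' i) by rewrite /B''; case: ifP.
  have um : uniq (rcons (iota 0 m) m).
    by rewrite rcons_uniq mem_iota ltnn andbF iota_uniq.
  have := indX um mB''; rewrite -cats1 big_cat/= big_seq1.
  have Bm : B'' m = B by rewrite /B'' eqxx.
  rewrite Bm.
  have ltm i : i \in iota 0 m -> B'' i = B' i.
    by rewrite mem_iota /B'' => /andP[_ im]; rewrite ltn_eqF.
  rewrite big_seq (eq_bigr (fun i => P (X i @^-1` B' i))); last first.
    by move=> i /ltm ->.
  rewrite -big_seq -indX ?iota_uniq// muleC => <-; congr (P _).
  apply/seteqP; split => w /=.
    move=> [h hm] i /=; rewrite mem_cat inE => /orP[im|/eqP->].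
      by rewrite ltm//; exact: h.
    by rewrite Bm.
  move=> h; split => [i im|].
    by rewrite -ltm//; apply: h; rewrite /= mem_cat im.
  have := h m; rewrite /= mem_cat inE eqxx orbT => /(_ isT).
  by rewrite Bm.
- by move=> k; rewrite /mrestr/= ltey_eq fin_num_measure//; exact: measurableI.
Qed.

End Independence.

(** * A maximal inequality for sums of independent Hilbert space vectors *)

Lemma measurable_lt_set d (Om : measurableType d) (R : realType)
    (f g : Om -> R) : measurable_fun setT f -> measurable_fun setT g ->
  measurable [set w | f w < g w].
Proof.
move=> mf mg; have := measurable_realfun.measurable_fun_ltr mf mg.
by move=> /(_ measurableT [set true] Logic.I); rewrite setTI; exact.
Qed.

Lemma measurable_stays_below d (Om : measurableType d) (R : realType)
    (Y : nat -> Om -> R) (b : nat -> R) N :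
  (forall i, (i <= N)%N -> measurable_fun setT (Y i)) ->
  measurable [set w | forall i, (i <= N)%N -> Y i w < b i].
Proof.
move=> mY; rewrite (_ : [set _ | _] =
    \bigcap_(i in [set i | (i <= N)%N]) [set w | Y i w < b i])//.
apply: bigcap_measurable => [|i /= iN]; first by exists 0%N.
exact: measurable_lt_set (mY i iN) (measurable_cst _).
Qed.

Lemma measurable_exceeds d (Om : measurableType d) (R : realType)
    (Y : nat -> Om -> R) (b : nat -> R) N :
  (forall m, measurable_fun setT (Y m)) ->
  measurable [set w | exists2 m, (m <= N)%N & b m < Y m w].
Proof.
move=> mY; rewrite (_ : [set _ | _] =
    \bigcup_(m in [set m | (m <= N)%N]) [set w | b m < Y m w]).
  apply: bigcup_measurable => m _.
  exact: measurable_lt_set (measurable_cst _) (mY m).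
by apply/seteqP; split => w [m ? ?]; exists m.
Qed.

Section Ville.
Context d (Om : measurableType d) (R : realType) (P : probability Om R).

(** Each step preserves the bound [G ^+ m] on the mean of [M m] while below the
    thresholds plus [a * G ^+ m] times the probability of having crossed one:
    at a first crossing, Markov's inequality trades mean for probability. *)
Lemma ville_inequality (M : nat -> Om -> R) (G a : R) (N : nat) :
  let stay m := [set w | forall i, (i <= m)%N -> M i w < a * G ^+ i] in
  0 < G -> 0 < a ->
  (forall m, measurable_fun setT (M m)) -> (forall m w, 0 <= M m w) ->
  (forall w, M 0%N w <= 1) ->
  (forall m, (\int[P]_(w in stay m) (M m.+1 w)%:E <=
              G%:E * \int[P]_(w in stay m) (M m w)%:E)%E) ->
  (P (~` stay N) <= (a^-1)%:E)%E.
Proof.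
move=> stay G0 a0 mM M0 M01 step.
have mstay m : measurable (stay m) by exact: measurable_stays_below.
have mE m D : measurable_fun D (fun w => (M m w)%:E).
  by apply: measurable_funTS; apply/measurable_EFinP.
have markov m D : measurable D -> D `<=` [set w | a * G ^+ m <= M m w] ->
    ((a * G ^+ m)%:E * P D <= \int[P]_(w in D) (M m w)%:E)%E.
  move=> mD DM; rewrite -integral_cst//; apply: ge0_le_integral => // w _.
  by rewrite lee_fin mulr_ge0 ?exprn_ge0// ltW.
have main m : (\int[P]_(w in stay m) (M m w)%:E + (a * G ^+ m)%:E * P (~` stay m)
    <= (G ^+ m)%:E)%E.
  elim: m => [|m IH].
    apply: (@le_trans _ _ (\int[P]_(w in stay 0%N `|` ~` stay 0%N) (M 0%N w)%:E)%E).
      have dj : [disjoint stay 0%N & ~` stay 0%N]%classic by exact/disj_setPCl.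
      rewrite ge0_integral_setU//=; [|exact: measurableC|by move=> w _; rewrite lee_fin].
      rewrite leeD2l// markov//; first exact: measurableC.
      move=> w /existsNP[i /not_implyP[]]; rewrite leqn0 => /eqP -> /negP.
      by rewrite -leNgt.
    rewrite setUv expr0 -(@probability_setT _ _ _ P) -[leRHS]mul1e -integral_cst//.
    apply: ge0_le_integral => //.
    - by move=> w _; rewrite lee_fin.
    - by move=> w _; rewrite lee_fin.
  pose D := stay m `\` stay m.+1.
  have mD : measurable D by exact: measurableD.
  have sD : stay m = stay m.+1 `|` D.
    rewrite /D setDE setUIr setUv setIT; apply/esym/setUidr => w h i im.
    by apply: h; exact: leq_trans im (leqnSn m).
  have DM : D `<=` [set w | a * G ^+ m.+1 <= M m.+1 w].
    move=> w [sw] /existsNP[i /not_implyP[]]; rewrite leq_eqVlt => /orP[/eqP ->|im].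
      by move=> /negP; rewrite -leNgt.
    by move=> []; exact: sw.
  have cD : ~` stay m.+1 `<=` ~` stay m `|` D.
    by move=> w nw; have [sw|sw] := pselect (stay m w); [right|left].
  apply: (@le_trans _ _ (\int[P]_(w in stay m.+1) (M m.+1 w)%:E
      + ((a * G ^+ m.+1)%:E * P (~` stay m) + (a * G ^+ m.+1)%:E * P D))%E).
    rewrite leeD2l// -ge0_muleDr// lee_pmul2l//; last 1 first.
    - by rewrite lte_fin mulr_gt0// exprn_gt0.
    apply: le_trans (measureU2 _ _ _) => //; last exact: measurableC.
    apply: le_measure cD => //; rewrite inE; first exact: measurableC.
    by apply: measurableU => //; exact: measurableC.
  apply: (@le_trans _ _ (\int[P]_(w in stay m) (M m.+1 w)%:E
      + (a * G ^+ m.+1)%:E * P (~` stay m))%E).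
    have dj : [disjoint stay m.+1 & D]%classic.
      by apply/disj_set2P; rewrite -subset0 => w [h [_ /(_ h)]].
    rewrite addeCA addeC [X in (_ <= \int[P]_(w in X) _ + _)%E]sD
      ge0_integral_setU//=; last first.
      by move=> w _; rewrite lee_fin.
    by rewrite leeD2r// leeD2l// markov.
  apply: (@le_trans _ _ (G%:E * (G ^+ m)%:E)%E); last by rewrite -EFinM exprS.
  apply: le_trans (lee_wpmul2l _ IH); last by rewrite lee_fin ltW.
  rewrite ge0_muleDr; last 2 first.
  - by apply: integral_ge0 => w _; rewrite lee_fin.
  - by rewrite mule_ge0// lee_fin mulr_ge0 ?exprn_ge0// ltW.
  by rewrite leeD// muleA -EFinM exprS mulrCA.
have GN : 0 < a * G ^+ N by rewrite mulr_gt0// exprn_gt0.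
rewrite -(@lee_pmul2l _ (a * G ^+ N)%:E)//.
rewrite -EFinM mulrAC divff ?gt_eqF// mul1r (le_trans _ (main N))//.
by rewrite leeDr//; apply: integral_ge0 => w _; rewrite lee_fin.
Qed.

End Ville.

Section HilbertSpace.
Context {R : realType} {V : hilbertType R}.
Implicit Types x y t : V.

Lemma hdotC x y : hdot x y = hdot y x.
Proof. by rewrite hermC expr0 mul1r. Qed.

Lemma normD_sqr x y : `|x + y| ^+ 2 = `|x| ^+ 2 + `|y| ^+ 2 + 2 * hdot x y.
Proof.
rewrite -!hdot_norm linearDl !linearDr/= (hdotC y x); ring.
Qed.

Lemma cauchy_schwarz x y : `|hdot x y| <= `|x| * `|y|.
Proof.
have H u : hdot u y <= `|u| * `|y|.
  have : `|u + y| ^+ 2 <= (`|u| + `|y|) ^+ 2.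
    by rewrite lerXn2r ?nnegrE ?addr_ge0// ler_normD.
  by rewrite normD_sqr sqrrD; lra.
rewrite ler_norml H andbT lerNl -(normrN x).
by have := H (- x); rewrite linearNl.
Qed.

(** The coefficient of the linear term depends on [t] only, so that this term
    has zero mean over a centered [x]. *)
Lemma cosh_normD (l : R) t : 0 <= l -> exists c : R, forall x,
  cosh (l * `|t + x|) <=
  cosh (l * `|t|) * (expR (l * `|x|) - l * `|x|) + c * hdot x t.
Proof.
move=> l0; exists (l * (sinh (l * `|t|) / `|t|)) => x.
(* The cosine of the angle; division by zero makes it 0 when [t] or [x] vanishes. *)
pose rho := hdot x t / (`|t| * `|x|).
have rhoE : rho * (`|t| * `|x|) = hdot x t.
  have [tx0|tx0] := eqVneq (`|t| * `|x|) 0; last by rewrite divfK.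
  rewrite tx0 mulr0; apply/esym/eqP; rewrite -normr_le0.
  by rewrite (le_trans (cauchy_schwarz _ _))// mulrC tx0.
have rho1 : -1 <= rho <= 1.
  rewrite -ler_norml normrM normfV normrM !normr_id.
  have [tx0|tx0] := eqVneq (`|t| * `|x|) 0; first by rewrite tx0 invr0 mulr0.
  rewrite ler_pdivrMr ?lt0r ?tx0 ?mulr_ge0// mul1r mulrC.
  exact: cauchy_schwarz.
have zE : (l * `|t + x|) ^+ 2 = (l * `|t|) ^+ 2 + (l * `|x|) ^+ 2
    + 2 * (rho * (l * `|t| * (l * `|x|))).
  by rewrite exprMn normD_sqr (hdotC t) -rhoE; ring.
have := cosh_law_of_cosines (mulr_ge0 l0 (normr_ge0 t)) (mulr_ge0 l0 (normr_ge0 x))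
  rho1 zE.
move=> /le_trans; apply; rewrite lerD2l le_eqVlt; apply/orP; left; apply/eqP.
have [t0|t0] := eqVneq `|t| 0.
  by rewrite t0 !(mulr0, mul0r) /sinh expR0 oppr0 expR0 subrr !(mulr0, mul0r).
by rewrite -rhoE; field.
Qed.

End HilbertSpace.

Section CoshStep.
Context d (Om : measurableType d) (R : realType) (P : probability Om R)
  (V : hilbertType R).
Hypothesis sepV : separable V.
Variables (X : Om -> V) (D s : R).
Hypotheses (mX : random_element X) (cX : centered P X).
Hypotheses (D0 : 0 < D) (s01 : 0 <= s <= 1).
Hypothesis psiX : ('E_P[(fun w => expR (`|X w| / D) - 1)%R] <= 1)%E.

Lemma measurable_hdot (t : V) : measurable_fun setT (fun w => hdot (X w) t).
Proof.
rewrite (_ : (fun _ => _) = fun w =>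
    (`|X w + t| ^+ 2 - `|X w| ^+ 2 - `|t| ^+ 2) * 2^-1); last first.
  by apply/funext => w; rewrite normD_sqr; field.
apply: measurable_funM => //; apply: measurable_funB => //.
apply: measurable_funB; apply: measurable_funX.
  apply: measurable_norm_random.
  by apply: random_elementD => //; exact: random_element_cst.
exact: measurable_norm_random.
Qed.

Lemma integrable_hdot (t : V) : P.-integrable setT (fun w => (hdot (X w) t)%:E).
Proof.
have [iX _] := cX.
apply: (le_integrable measurableT (f := fun w => (hdot (X w) t)%:E)
  (g := fun w => (`|t|%:E * (`|X w|)%:E)%E)) => //.
- by apply/measurable_EFinP; exact: measurable_hdot.
- move=> w _; rewrite -EFinM /= lee_fin normrM !normr_id mulrC.
  exact: cauchy_schwarz.
- exact: integrableZl.
Qed.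

(** The linear term of [cosh_normD] has zero mean, and what remains of order
    at least two in the norm of [X] is controlled by the exponential moment. *)
Lemma cosh_step (t : V) :
  (\int[P]_w (cosh (s / D * `|t + X w|))%:E <=
   ((1 + s ^+ 2) * cosh (s / D * `|t|))%:E)%E.
Proof.
have sD0 : 0 <= s / D by rewrite divr_ge0//; [case/andP: s01|exact: ltW].
have [c cP] := cosh_normD t sD0.
pose a := cosh (s / D * `|t|).
have a0 : 0 <= a by rewrite (le_trans ler01)// cosh_ge1.
pose e w := (expR (`|X w| / D) - 1)%R.
have me : measurable_fun setT e.
  apply: measurable_funB => //; apply: measurableT_comp => //.
  by apply: measurable_funM => //; exact: measurable_norm_random.
have e0 w : 0 <= e w.
  by rewrite subr_ge0 -expR0 ler_expR divr_ge0// ltW.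
have Ee : (\int[P]_w (e w)%:E <= 1)%E by move: psiX; rewrite unlock.
have ie : P.-integrable setT (fun w => (e w)%:E).
  apply/integrableP; split; first exact/measurable_EFinP.
  under eq_integral do rewrite gee0_abs ?lee_fin//.
  exact: le_lt_trans Ee (ltry _).
apply: (@le_trans _ _
  (\int[P]_w ((a%:E + (a * s ^+ 2)%:E * (e w)%:E) + c%:E * (hdot (X w) t)%:E))%E).
  apply: ge0_le_integral => //.
  - by move=> w _; rewrite lee_fin (le_trans ler01)// cosh_ge1.
  - apply/measurable_EFinP.
    rewrite /cosh; apply: measurable_funM => //.
    have mt : measurable_fun setT (fun w => `|t + X w|).
      apply: measurable_norm_random; apply: random_elementD => //.
      exact: random_element_cst.
    by apply: measurable_funD; apply: measurableT_comp => //;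
      [apply: measurable_funM|apply: measurableT_comp => //; apply: measurable_funM].
  - apply/measurable_EFinP => /=; apply: measurable_funD.
      by apply: measurable_funD => //; apply: measurable_funM.
    by apply: measurable_funM => //; exact: measurable_hdot.
  - move=> w _; rewrite -!EFinM -!EFinD lee_fin (le_trans (cP _))//.
    rewrite lerD2r (_ : a + _ = a * (1 + s ^+ 2 * e w)); last by ring.
    rewrite ler_wpM2l//.
    rewrite (_ : s / D * `|X w| = s * (`|X w| / D)); last by rewrite mulrAC mulrA.
    have v0 : 0 <= `|X w| / D by rewrite divr_ge0// ltW.
    have := expR_scale s01 v0; rewrite /e.
    have : 0 <= s ^+ 2 * (`|X w| / D) by rewrite mulr_ge0// sqr_ge0.
    by lra.
rewrite integralD//=; last 2 first.
- by apply: integrableD => //; [exact: finite_measure_integrable_cst|exact: integrableZl].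
- by apply: integrableZl => //; exact: integrable_hdot.
rewrite integralZl//; last exact: integrable_hdot.
have [_ /(_ t)] := cX; rewrite unlock => ->; rewrite mule0 adde0.
rewrite integralD//=; [|exact: finite_measure_integrable_cst|exact: integrableZl].
rewrite integralZl// integral_cst//= probability_setT mule1.
rewrite mulrDl mul1r EFinD leeD2l// (le_trans (lee_wpmul2l _ Ee))//.
  by rewrite lee_fin mulr_ge0// sqr_ge0.
by rewrite mule1 lee_fin mulrC.
Qed.

End CoshStep.

Section MaximalInequality.
Context d (Om : measurableType d) (R : realType) (P : probability Om R)
  (V : hilbertType R).
Hypothesis sepV : separable V.
Variables (X : nat -> Om -> V) (D : R).
Hypotheses (mX : forall i, random_element (X i)) (indX : independent P X).
Hypotheses (cX : forall i, centered P (X i)) (D0 : 0 < D).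
Hypothesis psiX :
  forall i, ('E_P[(fun w => expR (`|X i w| / D) - 1)%R] <= 1)%E.

Let S m w := \sum_(0 <= i < m) X i w.

Local Notation past m := (g_sigma_algebraType (cylinders X m)).

Lemma past_random_element m i : (i < m)%N ->
  random_element (X i : past m -> V).
Proof.
move=> im B mB; apply: sub_gen_smallest.
exists (fun j => if j == i then B else setT) => [j|].
  by case: ifP => // _; exact: (@measurableT _ (borel_type V)).
apply/seteqP; split => w /=.
  by move=> XB j _ /=; case: eqP => [->|].
by move=> /(_ i); rewrite /= eqxx mem_iota; exact.
Qed.

Lemma past_random_sum m k : (k <= m)%N -> random_element (S k : past m -> V).
Proof.
move=> km; apply: random_element_sum => // i.
rewrite mem_index_iota => /andP[_ ik].
by apply: past_random_element; exact: leq_trans km.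
Qed.

Lemma random_partial_sum m : random_element (S m).
Proof. exact: random_element_sum. Qed.

Section Step.
Variable s : R.
Hypothesis s01 : 0 <= s <= 1.
Let l := s / D.
Let G := 1 + s ^+ 2.
Let M m w := cosh (l * `|S m w|).

Lemma measurable_cosh_norm d' (T : measurableType d') (Y : T -> V) :
  random_element Y -> measurable_fun setT (fun w => cosh (l * `|Y w|)).
Proof.
move=> /measurable_norm_random mY; rewrite /cosh; apply: measurable_funM => //.
by apply: measurable_funD; apply: measurableT_comp => //;
  [apply: measurable_funM|apply: measurableT_comp => //; apply: measurable_funM].
Qed.

(** With the first [m] variables frozen, the region of integration and [S m]
    are constants and [cosh_step] applies to the next variable. *)
Lemma cosh_sum_step (a : R) m
    (stay := [set w | forall i, (i <= m)%N -> M i w < a * G ^+ i]) :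
  (\int[P]_(w in stay) (M m.+1 w)%:E <= G%:E * \int[P]_(w in stay) (M m w)%:E)%E.
Proof.
have Mge1 k w : 1 <= M k w by exact: cosh_ge1.
have mstay : measurable (stay : set (past m)).
  apply: measurable_stays_below => i im.
  exact: measurable_cosh_norm (past_random_sum im).
have pastE (E : set Om) : measurable (E : set (past m)) -> measurable E.
  move: E; apply: smallest_sub; first exact: sigma_algebra_measurable.
  by move=> _ [B mB ->]; apply: fin_bigcap_measurable => // i _; exact: mX.
have mstay' : measurable (stay : set Om) by exact: pastE.
have mid : measurable_fun setT (id : Om -> past m).
  by move=> _ E mE; rewrite setTI; exact: pastE.
pose f (z : past m * borel_type V) : \bar R :=
  (\1_stay z.1 * cosh (l * `|S m z.1 + z.2|))%:E.
have mf : measurable_fun setT f.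
  apply/measurable_EFinP; apply: measurable_funM.
    have m1 : measurable_fun setT (\1_stay : past m -> R) by exact: measurable_indic.
    exact: (measurableT_comp m1 measurable_fst).
  apply: measurable_cosh_norm; apply: random_elementD => //.
    apply/random_elementP.
    have /random_elementP := past_random_sum (leqnn m).
    by move=> /measurableT_comp; apply.
  by apply/random_elementP; exact: measurable_snd.
have f0 z : (0 <= f z)%E.
  by rewrite lee_fin mulr_ge0// (le_trans ler01)// cosh_ge1.
have fE : (\int[P]_(w in stay) (M m.+1 w)%:E = \int[P]_w f (w, X m w))%E.
  rewrite integral_mkcond; apply: eq_integral => w _.
  rewrite patchE /f/= indicE /M /S big_nat_recr//=.
  by case: ifP => _; rewrite ?mul1r ?mul0r.
rewrite fE (@ge0_integral_independent _ _ _ _ (past m) (borel_type V) _ P id (X m))//.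
- rewrite [in leRHS]integral_mkcond -ge0_integralZl//; last 3 first.
  + apply/(measurable_restrictT _ mstay')/measurable_funTS/measurable_EFinP.
    exact: measurable_cosh_norm (random_partial_sum m).
  + move=> w _; rewrite patchE; case: ifP => // _.
    by rewrite lee_fin (le_trans ler01).
  + by rewrite lee_fin addr_ge0// sqr_ge0.
  apply: ge0_le_integral => //.
  + by move=> w _; exact: integral_ge0.
  + have mF : measurable_fun setT
        ((fun w => \int[P]_w' f (w, X m w'))%E : past m -> \bar R).
      have mXb : measurable_fun setT (X m : Om -> borel_type V) by exact/random_elementP.
      exact: (measurable_integral_frozen P mXb mf f0).
    exact: (measurableT_comp mF mid).
  + apply: emeasurable_funM => //.
    apply/(measurable_restrictT _ mstay')/measurable_funTS/measurable_EFinP.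
    exact: measurable_cosh_norm (random_partial_sum m).
  move=> w _; rewrite patchE /f/= indicE; case: ifP => _.
    under eq_integral do rewrite mul1r.
    exact: cosh_step.
  under eq_integral do rewrite mul0r.
  by rewrite integral0 mule0.
- exact/random_elementP.
- by move=> A B mA mB; rewrite preimage_id; exact: past_independent.
Qed.

Lemma cosh_maximal (a : R) N : 0 < a ->
  (P [set w | exists2 m, (m <= N)%N & (a * G ^+ m < M m w)%R] <= (a^-1)%:E)%E.
Proof.
move=> a0.
have mM m : measurable_fun setT (M m).
  exact: measurable_cosh_norm (random_partial_sum m).
have M1 m w : 1 <= M m w by exact: cosh_ge1.
have G0 : 0 < G by rewrite ltr_pwDl// sqr_ge0.
have M01 w : M 0%N w <= 1.
  by rewrite /M /S big_geq// normr0 mulr0 /cosh oppr0 expR0; lra.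
apply: le_trans (ville_inequality N G0 a0 mM _ M01 (cosh_sum_step a)); last first.
  by move=> m w; rewrite (le_trans ler01).
apply: le_measure.
- by rewrite inE; exact: measurable_exceeds.
- by rewrite inE; apply: measurableC; exact: measurable_stays_below.
- by move=> w [m mN lt_m] /(_ m mN); rewrite ltNge (ltW lt_m).
Qed.

End Step.

(** With [u := y / D], crossing the threshold at time [m] makes
    [cosh (l * `|S m|) / (1 + s ^+ 2) ^+ m] at least half the exponential of
    [(s * u - s ^+ 2) * max m rho]. The choice [s := u / (2 * (1 + u))] stays
    below one and below [u / 2], hence the exponent [s * u / 2], quadratic for
    small [u] and linear for large [u]. *)
Lemma maximal_inequality (y rho : R) N : 0 < y -> 0 <= rho ->
  (P [set w | exists2 m, (m <= N)%N &
       (y * Num.max m%:R rho < `|\sum_(0 <= i < m) X i w|)%R] <=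
   (2 * expR (- ((y / D) ^+ 2 / (4 * (1 + y / D)) * rho)))%:E)%E.
Proof.
move=> y0 rho0; pose u := y / D; rewrite -/u.
have u0 : 0 < u by rewrite divr_gt0.
pose s := u / (2 * (1 + u)); pose k := u ^+ 2 / (4 * (1 + u)).
have s01 : 0 <= s <= 1.
  by apply/andP; split; [apply: divr_ge0; lra|rewrite ler_pdivrMr; lra].
have su2 : s <= u / 2.
  by rewrite ler_pdivrMr; [nra|lra].
have s0 : 0 < s by rewrite divr_gt0//; lra.
have a0 : 0 < expR (k * rho) / 2 by rewrite divr_gt0// expR_gt0.
apply: le_trans (_ : (expR (k * rho) / 2)^-1%:E <= _)%E; last first.
  by rewrite lee_fin invf_div expRN.
apply: le_trans (cosh_maximal s01 N a0); apply: le_measure.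
- rewrite inE; apply: measurable_exceeds => m.
  exact: measurable_norm_random (random_partial_sum m).
- rewrite inE; apply: measurable_exceeds => m.
  exact: measurable_cosh_norm (random_partial_sum m).
move=> w [m mN Sm]; exists m => //.
apply: lt_le_trans (cosh_ge_half_expR _).
rewrite mulrAC ltr_pM2r//.
apply: (@le_lt_trans _ _ (expR (k * rho) * expR (s ^+ 2 * m%:R))).
  rewrite ler_pM2l ?expR_gt0// mulrC expRM_natl.
  by rewrite lerXn2r ?nnegrE ?expR_ge0 ?expR_ge1Dx// addr_ge0// sqr_ge0.
rewrite -expRD ltr_expR.
have : s * (u * Num.max m%:R rho) < s / D * `|S m w|.
  rewrite (_ : s * (u * _) = s / D * (y * Num.max m%:R rho)); last first.
    by rewrite /u; field; rewrite gt_eqF.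
  by rewrite ltr_pM2l// divr_gt0.
apply: le_lt_trans.
have qx : m%:R <= Num.max m%:R rho by rewrite le_max lexx.
have rx : rho <= Num.max m%:R rho by rewrite le_max lexx orbT.
have kE : k = s * (u / 2) by rewrite /k /s; field; lra.
have h1 : s * (u / 2) * rho <= s * (u / 2) * Num.max m%:R rho.
  by rewrite ler_wpM2l// mulr_ge0//; lra.
have h2 : s * (s * m%:R) <= s * (u / 2 * Num.max m%:R rho).
  by rewrite ler_wpM2l//; [lra|rewrite ler_pM//; lra].
by rewrite kE expr2; lra.
Qed.

End MaximalInequality.

(** * Linear processes *)

Section OperatorNorm.
Context {R : realType} {V W : normedModType R}.
Implicit Type A : {linear V -> W}.

Lemma op_norm_ge0 A : (0 <= op_norm A)%E.
Proof.
apply: ereal_sup_ubound; exists 0; rewrite /= ?normr0//.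
by rewrite linear0 normr0.
Qed.

Lemma op_normP A x : op_norm A \is a fin_num ->
  `|A x| <= fine (op_norm A) * `|x|.
Proof.
move=> fA; have [->|x0] := eqVneq x 0; first by rewrite linear0 !normr0 mulr0.
have nx0 : 0 < `|x| by rewrite normr_gt0.
rewrite -ler_pdivrMr// -lee_fin fineK//; apply: ereal_sup_ubound.
exists (`|x|^-1 *: x) => /=.
  by rewrite normrZ normfV normr_id mulVf// gt_eqF.
by rewrite linearZ/= normrZ normfV normr_id mulrC.
Qed.

End OperatorNorm.

Section ExponentialMoment.
Context d (Om : measurableType d) (R : realType) (P : probability Om R).

Lemma same_law_integral (V : normedModType R) (X Y : Om -> V)
    (f : borel_type V -> \bar R) :
  random_element X -> random_element Y -> same_law P X Y ->
  measurable_fun setT f -> (forall x, 0 <= f x)%E ->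
  (\int[P]_w f (X w) = \int[P]_w f (Y w))%E.
Proof.
move=> /random_elementP mX /random_elementP mY XY mf f0.
pose X' : {mfun Om >-> borel_type V} :=
  HB.pack (X : Om -> borel_type V) (isMeasurableFun.Build _ _ _ _ _ mX).
pose Y' : {mfun Om >-> borel_type V} :=
  HB.pack (Y : Om -> borel_type V) (isMeasurableFun.Build _ _ _ _ _ mY).
transitivity (\int[distribution P X']_z f z)%E.
  by rewrite ge0_integral_distribution.
transitivity (\int[distribution P Y']_z f z)%E.
  by apply: eq_measure_integral => A mA _; exact: XY.
by rewrite ge0_integral_distribution.
Qed.

(** The factor two leaves room for the infimum defining the norm not to be
    attained. *)
Lemma psi1_norm_exp_moment (X : Om -> R) (D : R) :
  measurable_fun setT X -> 0 < D -> (psi1_norm P X <= D%:E)%E ->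
  ('E_P[(fun w => expR (`|X w| / (2 * D)) - 1)%R] <= 1)%E.
Proof.
move=> mX D0 XD.
have : (psi1_norm P X < (2 * D)%:E)%E.
  by rewrite (le_lt_trans XD)// lte_fin; lra.
move=> /ereal_inf_lt[_ [B [B0 EB] <-]]; rewrite lte_fin => BD.
have me b : measurable_fun setT (fun w => (expR (`|X w| / b) - 1)%:E).
  apply/measurable_EFinP; apply: measurable_funB => //.
  apply: measurableT_comp => //; apply: measurable_funM => //.
  exact: measurableT_comp.
apply: le_trans EB; rewrite unlock; apply: ge0_le_integral => //.
- by move=> w _; rewrite lee_fin subr_ge0 -[leLHS]expR0 ler_expR divr_ge0//; lra.
- move=> w _; rewrite lee_fin lerD2r ler_expR ler_wpM2l// lef_pV2 ?posrE//; lra.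
Qed.

End ExponentialMoment.

Lemma geometric_sum_le (R : realFieldType) (q : R) n : 0 <= q -> q <= 2^-1 ->
  \sum_(0 <= j < n) q ^+ j.+1 <= 2 * q.
Proof.
move=> q0 q2.
suff : \sum_(0 <= j < n) q ^+ j.+1 + 2 * q ^+ n.+1 <= 2 * q.
  by have := exprn_ge0 n.+1 q0; lra.
elim: n => [|n IH]; first by rewrite big_geq// expr1 add0r.
rewrite big_nat_recr//=; apply: le_trans IH; rewrite -addrA lerD2l.
have : q ^+ n.+2 <= q ^+ n.+1 * 2^-1.
  by rewrite exprSr ler_wpM2l// exprn_ge0.
by have := exprn_ge0 n.+1 q0; lra.
Qed.

Lemma cvg_sum_nat (R : realType) (V : normedModType R) (u : nat -> nat -> V)
    (l : nat -> V) m :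
  (forall i, u i n @[n --> \oo] --> l i) ->
  \sum_(0 <= i < m) u i n @[n --> \oo] --> \sum_(0 <= i < m) l i.
Proof.
move=> ul; elim: m => [|m IH].
  rewrite big_geq//; under eq_fun do rewrite big_geq//; exact: cvg_cst.
rewrite big_nat_recr//=; under eq_fun do rewrite big_nat_recr//=.
exact: cvgD.
Qed.

Section LinearProcess.
Context d (Om : measurableType d) (R : realType) (P : probability Om R)
  (V : hilbertType R).
Hypothesis sepV : separable V.
Variables (A : nat -> {linear V -> V}) (eta eps : int -> Om -> V) (CA D : R).
Hypotheses (CA0 : 0 < CA) (D0 : 0 < D).
Hypothesis A_sum : (\sum_(0 <= j <oo) (j.+1%:R%:E * op_norm (A j)) <= CA%:E)%E.
Hypotheses (mEta : forall i, random_element (eta i)) (indEta : independent P eta).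
Hypothesis cEta : forall i, centered P (eta i).
Hypothesis psiEta :
  forall i, ('E_P[(fun w => expR (`|eta i w| / D) - 1)%R] <= 1)%E.
Hypothesis mEps : forall i, random_element (eps i).
Hypothesis epsE : forall i, {ae P, forall w,
  \sum_(0 <= j < N) A j (eta (i - j%:Z) w) @[N --> \oo] --> eps i w}.

Let a j := fine (op_norm (A j)).

Lemma partial_sum_op_norm_le n :
  (\sum_(0 <= j < n) (j.+1%:R%:E * op_norm (A j)) <= CA%:E)%E.
Proof.
apply: le_trans A_sum; apply: nneseries_lim_ge => j _ _.
by rewrite mule_ge0// op_norm_ge0.
Qed.

Lemma op_norm_fin j : op_norm (A j) \is a fin_num.
Proof.
rewrite ge0_fin_numE ?op_norm_ge0//.
apply: le_lt_trans (ltry CA).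
apply: le_trans (partial_sum_op_norm_le j.+1).
rewrite big_nat_recr//=; apply: le_trans (leeDr _ _); last first.
  by apply: sume_ge0 => i _; rewrite mule_ge0// op_norm_ge0.
by rewrite -{1}[op_norm _]mul1e lee_wpmul2r ?op_norm_ge0// lee_fin ler1n.
Qed.

Lemma weighted_op_norm_sum_le n : \sum_(0 <= j < n) j.+1%:R * a j <= CA.
Proof.
rewrite -lee_fin -sumEFin; apply: le_trans (partial_sum_op_norm_le n).
by apply: lee_sum => j _; rewrite EFinM fineK// op_norm_fin.
Qed.

(** Each lag [j] gets a share of the threshold proportional to [j.+1]: these
    shares add up to at most the whole threshold, by the weighted summability
    of the operator norms. *)
Lemma norm_linear_process_le w (sg : nat -> int) m (b : R) : 0 <= b ->
  (forall i, \sum_(0 <= j < N) A j (eta (sg i - j%:Z) w) @[N --> \oo]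
     --> eps (sg i) w) ->
  (forall j, `|\sum_(0 <= i < m) eta (sg i - j%:Z) w| <= j.+1%:R / CA * b) ->
  `|\sum_(0 <= i < m) eps (sg i) w| <= b.
Proof.
move=> b0 /cvg_sum_nat => /(_ m) /cvg_norm epsl bnd.
apply: (ler_cvg_to epsl (cvg_cst b)); near=> n.
rewrite exchange_big/=; under eq_bigr do rewrite -linear_sum.
rewrite (le_trans (ler_norm_sum _ _ _))//.
apply: (@le_trans _ _ (\sum_(0 <= j < n) j.+1%:R * a j * (b / CA))).
  apply: ler_sum => j _; rewrite (le_trans (op_normP _ (op_norm_fin j)))//.
  rewrite -/(a j) -[leRHS]mulrA mulrCA ler_wpM2l//.
    by rewrite fine_ge0// op_norm_ge0.
  by rewrite (le_trans (bnd j))// mulrA mulrAC.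
rewrite -mulr_suml mulrA ler_pdivrMr// mulrC ler_wpM2l//.
exact: weighted_op_norm_sum_le.
Unshelve. all: by end_near. Qed.

(** Union bound over the lags [j]: the threshold of lag [j] is [j.+1] times that
    of lag 0, and [u ^+ 2 / (1 + u)] grows at least [j.+1] times when [u] is
    multiplied by [j.+1], so the failure probability of lag [j] is at most [2 * q ^+ j.+1]. The map [sg]
    lets the sums run forwards or backwards in time. *)
Lemma linear_process_maximal (sg : nat -> int) (sg' : int -> nat) (y rho : R) N
    (u := y / (CA * D)) (q := expR (- (u ^+ 2 / (4 * (1 + u)) * rho))) :
  cancel sg sg' -> 0 < y -> 0 <= rho -> q <= 2^-1 ->
  (P [set w | exists2 m, (m <= N)%N &
       (y * Num.max m%:R rho < `|\sum_(0 <= i < m) eps (sg i) w|)%R] <=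
   (4 * q)%:E)%E.
Proof.
move=> sgK y0 rho0 q2.
set E := [set w | _].
have mE : measurable E.
  apply: measurable_exceeds => m; apply: measurable_norm_random.
  exact: random_element_sum.
pose F j := [set w | exists2 m, (m <= N)%N &
  y * j.+1%:R / CA * Num.max m%:R rho < `|\sum_(0 <= i < m) eta (sg i - j%:Z) w|].
have mF j : measurable (F j).
  apply: measurable_exceeds => m; apply: measurable_norm_random => //.
  exact: random_element_sum.
have : {ae P, forall w, forall i, \sum_(0 <= j < N) A j (eta (sg i - j%:Z) w)
    @[N --> \oo] --> eps (sg i) w} by exact: ae_foralln.
move=> [Z [mZ PZ Zsub]].
(* Off the null set [Z], all the series defining the noise converge. *)
have EF : E `<=` Z `|` \bigcup_j F j.
  move=> w [m mN Em]; have [|nZ] := pselect (Z w); first by left.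
  right; apply: contrapT => nF.
  move: Em; rewrite ltNge => /negP; apply.
  apply: norm_linear_process_le.
  - by rewrite mulr_ge0 ?le_max ?ler0n// ltW.
  - by apply: contrapT => nC; apply: nZ; apply: Zsub.
  - move=> j; rewrite leNgt; apply/negP => lt_j; apply: nF.
    exists j => //; exists m => //; apply: le_lt_trans lt_j.
    by rewrite le_eqVlt; apply/orP; left; apply/eqP; ring.
have PF j : (P (F j) <= (2 * q ^+ j.+1)%:E)%E.
  have yj0 : 0 < y * j.+1%:R / CA by rewrite divr_gt0// mulr_gt0.
  have sgjK : cancel (fun i => sg i - j%:Z) (fun z => sg' (z + j%:Z)).
    by move=> i; rewrite /= subrK sgK.
  apply: le_trans (maximal_inequality sepV (X := fun i => eta (sg i - j%:Z))
    (fun i => mEta _) (independent_reindex sgjK indEta) (fun i => cEta _) D0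
    (fun i => psiEta _) N yj0 rho0) _.
  have u0 : 0 < u by rewrite divr_gt0// mulr_gt0.
  have -> : y * j.+1%:R / CA / D = j.+1%:R * u.
    by rewrite /u invfM !mulrA; congr (_ / _ / _); rewrite mulrC.
  rewrite lee_fin ler_pM2l// -expRM_natl ler_expR mulrN lerN2 mulrA.
  rewrite ler_wpM2r//.
  have : 1 <= j.+1%:R :> R by rewrite ler1n.
  move: (j.+1%:R) => r r1.
  rewrite ler_pdivlMr ?mulr_gt0//; last by nra.
  set v := u ^+ 2 / _.
  have v0 : 0 <= v by rewrite divr_ge0 ?sqr_ge0//; lra.
  have vE : u ^+ 2 = v * (4 * (1 + u)) by rewrite /v; field; lra.
  rewrite exprMn vE -subr_ge0 (_ : _ - _ = 4 * r * v * (r - 1)); last by ring.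
  by rewrite mulr_ge0 ?subr_ge0// mulr_ge0// mulr_ge0//; lra.
have mU : measurable (\bigcup_j F j) by exact: bigcupT_measurable.
apply: le_trans (_ : P (Z `|` \bigcup_j F j) <= _)%E.
  by apply: le_measure EF; rewrite inE//; exact: measurableU.
rewrite (le_trans (measureU2 _ mZ mU))// [X in (X + _)%E]PZ add0e.
rewrite (le_trans (measure_sigma_subadditive _ mF mU (@subset_refl _ _)))//.
apply: lime_le; first by apply: is_cvg_nneseries => *; exact: measure_ge0.
near=> n; apply: le_trans (_ : (\sum_(0 <= j < n) (2 * q ^+ j.+1)%:E <= _)%E).
  by apply: lee_sum => j _; exact: PF.
rewrite sumEFin lee_fin -mulr_sumr.
have := geometric_sum_le n (expR_ge0 _ : 0 <= q) q2.
by lra.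
Unshelve. all: by end_near. Qed.

End LinearProcess.

(** * The maximizer of the CUSUM process *)

Section Argmax.
Context {R : realType}.

Lemma bigmax_attained (F : nat -> R) (s : seq nat) :
  s != [::] -> (forall i, 0 <= F i) ->
  exists2 t, t \in s & \big[Num.max/0]_(i <- s) F i = F t.
Proof.
move=> s0 F0; elim: s s0 => // a s IH _; rewrite big_cons.
have [->|/IH[t ts ->]] := eqVneq s [::].
  by exists a; rewrite ?mem_head// big_nil; apply/max_idPl.
have [le_at|lt_ta] := leP (F a) (F t).
  by exists t => //; rewrite inE ts orbT.
by exists a; rewrite ?mem_head.
Qed.

Lemma ler_bigmax (F : nat -> R) (s : seq nat) t :
  t \in s -> F t <= \big[Num.max/0]_(i <- s) F i.
Proof.
elim: s => // a s IH; rewrite inE big_cons le_max => /orP[/eqP->|/IH->].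
  by rewrite lexx.
by rewrite orbT.
Qed.

Lemma omega_hat_argmax (V : normedModType R) n (f : nat -> V) : (0 < n)%N ->
  (1 <= omega_hat n f <= n)%N /\
  forall t, (1 <= t <= n)%N -> `|cusum n f t| <= `|cusum n f (omega_hat n f)|.
Proof.
move=> n0; set F := fun t => `|cusum n f t| ^+ 2.
have F0 t : 0 <= F t by rewrite sqr_ge0.
have iotaE : index_iota 1 n.+1 = iota 1 n by rewrite /index_iota subn1.
have [|t tn maxt] := @bigmax_attained F (index_iota 1 n.+1) _ F0.
  by rewrite -size_eq0 size_iota subn1 -lt0n.
have : omega_hat n f \in [seq s <- iota 1 n |
    F s == \big[Num.max/0]_(1 <= t < n.+1) F t].
  rewrite /omega_hat -/F; set l := [seq _ <- _ | _].
  have : t \in l by rewrite mem_filter -iotaE tn maxt eqxx.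
  by case: l => // a l _; rewrite mem_head.
rewrite mem_filter mem_iota add1n ltnS => /andP[/eqP maxE ->]; split=> // u un.
rewrite -ler_sqr ?nnegrE//; rewrite -/(F u) -/(F (omega_hat n f)) maxE.
by apply: ler_bigmax; rewrite mem_index_iota.
Qed.

End Argmax.

Section ArgmaxMeasurable.
Context d (Om : measurableType d) (R : realType).

Lemma measurable_head_filter (p : nat -> Om -> bool) (Q : set nat) (l : seq nat) :
  (forall s, measurable [set w | p s w]) ->
  measurable [set w | Q (head 0%N [seq s <- l | p s w])].
Proof.
move=> mp; elim: l => [|a l IH] /=.
  have [q|nq] := pselect (Q 0%N).
    by rewrite (_ : [set _ | _] = setT)//; apply/seteqP; split.
  by rewrite (_ : [set _ | _] = set0)//; apply/seteqP; split.
rewrite (_ : [set _ | _] = ([set w | p a w] `&` [set _ | Q a]) `|`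
    (~` [set w | p a w] `&` [set w | Q (head 0%N [seq s <- l | p s w])])).
  apply: measurableU; apply: measurableI => //; last exact: measurableC.
  have [q|nq] := pselect (Q a).
    by rewrite (_ : [set _ | _] = setT)//; apply/seteqP; split.
  by rewrite (_ : [set _ | _] = set0)//; apply/seteqP; split.
apply/seteqP; split => w /=; case: (p a w) => //=.
- by left.
- by right.
- by move=> [[]|[]].
- by move=> [[]|[]].
Qed.

Lemma measurable_bigmax (F : nat -> Om -> R) (s : seq nat) :
  (forall i, measurable_fun setT (F i)) ->
  measurable_fun setT (fun w => \big[Num.max/0]_(i <- s) F i w).
Proof.
move=> mF; elim: s => [|a s IH].
  by under eq_fun do rewrite big_nil; exact: measurable_cst.
by under eq_fun do rewrite big_cons; exact: measurable_maxr.
Qed.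

Lemma measurable_omega_hat (V : normedModType R) n (f : Om -> nat -> V) (Q : set nat) :
  separable V -> (forall i, random_element (fun w => f w i)) ->
  measurable [set w | Q (omega_hat n (f w))].
Proof.
move=> sepV mf.
have mN s : measurable_fun setT (fun w => `|cusum n (f w) s| ^+ 2).
  apply: measurable_funX; apply: measurable_norm_random.
  apply: random_elementZ => //; apply: random_element_sum => // i _.
  apply: random_elementD => //.
  rewrite (_ : (fun _ => _) = fun w => -1 *: sample_mean n (f w)).
    by do 2 apply: random_elementZ => //; exact: random_element_sum.
  by apply/funext => w; rewrite scaleN1r.
have mM := measurable_bigmax (index_iota 1 n.+1) mN.
apply: measurable_head_filter => s.
have m1 := measurable_realfun.measurable_fun_ler (mN s) mM.
have m2 := measurable_realfun.measurable_fun_ler mM (mN s).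
have := measurableI _ _ (m1 measurableT [set true] Logic.I)
  (m2 measurableT [set true] Logic.I).
rewrite !setTI; congr measurable; apply/seteqP; split => w /=.
  by move=> [h1 h2]; rewrite eq_le h1 h2.
by move=> /eqP ->; rewrite lexx.
Qed.

End ArgmaxMeasurable.

Section Deterministic.
Context {R : realType} {V : normedModType R}.
Variables (n om : nat) (mu delta : V) (e : int -> V).
Hypothesis omn : (1 <= om <= n - 1)%N.

Let f i := mu + (om < i)%N%:R *: delta + e i%:Z.
Let S s := \sum_(1 <= i < s.+1) e i%:Z.
Let Z s := S s - (s%:R / n%:R) *: S n.
(** The tent [s * (n - om) / n] for [s <= om] and [om * (n - s) / n] for
    [s >= om], in one formula thanks to truncated subtraction. *)
Let h (s : nat) : R := s%:R * (1 - om%:R / n%:R) - (s - om)%N%:R.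

Let n0 : (0 < n)%N. Proof. by case: n omn => //; case: om. Qed.
Let omn' : (om < n)%N.
Proof. by move: omn n0; case: n => // m; rewrite subn1/= => /andP[_]. Qed.

Lemma sum_observation s :
  \sum_(1 <= i < s.+1) f i = s%:R *: mu + (s - om)%N%:R *: delta + S s.
Proof.
elim: s => [|s IH].
  by rewrite /S !big_geq// sub0n !scale0r !addr0.
rewrite big_nat_recr//= IH /S [in RHS]big_nat_recr//= /f.
rewrite addrACA [X in X + _ = _]addrACA; congr (_ + _); congr (_ + _).
  by rewrite -natr1 scalerDl scale1r.
rewrite -scalerDl -natrD; congr (_%:R *: _); rewrite ltnS.
by case: (leqP om s) => so; lia.
Qed.

Lemma cusumE s : (s <= n)%N ->
  Num.sqrt n%:R *: cusum n f s = Z s - h s *: delta.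
Proof.
move=> sn; have n0' : n%:R != 0 :> R by rewrite pnatr_eq0 -lt0n.
rewrite /cusum scalerA divff ?scale1r; last first.
  by rewrite sqrtr_eq0 -ltNge ltr0n.
rewrite sumrB sumr_const_nat subn1/= -scaler_nat sum_observation.
rewrite /sample_mean sum_observation !(scalerDr, scalerA).
rewrite -mulrA mulVf// mulr1 opprD addrACA addrC; congr (_ + _).
rewrite opprD addrACA subrr add0r -scalerBl -[RHS]scaleNr; congr (_ *: _).
by rewrite (natrB _ (ltnW omn')) /h; field.
Qed.

Lemma tent_gap s : (s <= n)%N ->
  h om - h s = if (s <= om)%N then (om - s)%N%:R * (1 - om%:R / n%:R)
               else (s - om)%N%:R * (om%:R / n%:R).
Proof.
move=> sn; rewrite /h subnn subr0; case: leqP => so.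
  by rewrite (natrB _ so) (_ : (s - om = 0)%N) ?subr0; [ring|lia].
by rewrite (natrB _ (ltnW so)); ring.
Qed.

Let dist s := maxn (s - om) (om - s).

(** Triangle inequality, after writing the rescaled process at [s] as the
    proportion [tau] of its value at the change point plus the noise
    [(Z s - Z om) + (1 - tau) *: Z om]. *)
Lemma cusum_drop s (tau := h s / h om) : (s <= n)%N -> 0 < h om -> 0 <= tau ->
  tau <= 1 -> `|cusum n f om| <= `|cusum n f s| ->
  (1 - tau) * (h om * `|delta| - 2 * `|Z om|) <= `|Z s - Z om|.
Proof.
move=> sn h0 tau0 tau1 le_cusum.
set g := Z om - h om *: delta.
have le_g : `|g| <= `|Z s - h s *: delta|.
  rewrite /g -(cusumE sn) -(cusumE (ltnW omn')).
  by rewrite (normrZ _ (cusum n f om)) (normrZ _ (cusum n f s)) ler_wpM2l.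
have gE : Z s - h s *: delta = tau *: g + (Z s - Z om) + (1 - tau) *: Z om.
  have tE : tau * h om = h s by rewrite /tau divfK ?gt_eqF.
  rewrite /g scalerBr scalerA tE (scalerBl 1 tau) scale1r.
  by rewrite -[RHS]addrA subrKA [RHS]addrC subrKA.
have g_ge : h om * `|delta| - `|Z om| <= `|g|.
  have -> : h om * `|delta| = `|h om *: delta| by rewrite normrZ gtr0_norm.
  by rewrite -[`|g|]normrN opprB; exact: lerB_dist.
have : `|g| <= tau * `|g| + `|Z s - Z om| + (1 - tau) * `|Z om|.
  apply: le_trans le_g _; rewrite gE (le_trans (ler_normD _ _))//.
  rewrite normrZ (ger0_norm (_ : 0 <= 1 - tau)) ?subr_ge0// lerD2r.
  by rewrite (le_trans (ler_normD _ _))// normrZ ger0_norm.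
move: g_ge; set x := `|g|; set z := `|Z om|; set v := `|Z s - Z om|.
have : 0 <= 1 - tau by rewrite subr_ge0.
by nra.
Qed.

Lemma sum_increment a b : (a <= b)%N ->
  S b - S a = \sum_(a.+1 <= i < b.+1) e i%:Z.
Proof.
move=> ab; have : S b = S a + \sum_(a.+1 <= i < b.+1) e i%:Z.
  by rewrite /S (@big_cat_nat _ _ _ a.+1 1 b.+1).
by move=> ->; rewrite addrAC subrr add0r.
Qed.

Lemma forward_sum s : (om <= s)%N ->
  S s - S om = \sum_(0 <= i < s - om) e ((om.+1)%:Z + i%:Z).
Proof.
move=> so; rewrite sum_increment//.
rewrite -{1}[om.+1]add0n big_addn subSS.
by apply: eq_bigr => i _; rewrite addnC PoszD.
Qed.

Lemma backward_sum s : (s <= om)%N ->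
  S om - S s = \sum_(0 <= i < om - s) e (om%:Z - i%:Z).
Proof.
move=> so; rewrite sum_increment//.
rewrite big_nat_rev/= -{1}[s.+1]add0n big_addn subSS.
rewrite !big_nat; apply: eq_bigr => i /andP[_ ilt]; congr (e _).
by lia.
Qed.

(** Suppose that [s] is at distance [m >= rho] and let [g] be the smaller of
    [om / n] and [1 - om / n]. Then [rho <= n], so the hypotheses give
    [`|Z om| <= 3 * y * n] and [`|Z s - Z om| <= 3 * y * m], whereas the tent
    drops by at least [g * m] and has height at least [g * n / 2]. With the
    constant 16 in [y], [cusum_drop] would then read
    [h om / 4 <= 3 * h om / 16] up to a positive factor. *)
Lemma argmax_close s (rho : R)
    (y := Num.min (om%:R / n%:R) (1 - om%:R / n%:R) * `|delta| / 16) :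
  delta != 0 -> (s <= n)%N ->
  (forall m, (m <= n)%N ->
    `|\sum_(0 <= i < m) e ((om.+1)%:Z + i%:Z)| <= y * Num.max m%:R rho) ->
  (forall m, (m <= n)%N ->
    `|\sum_(0 <= i < m) e (om%:Z - i%:Z)| <= y * Num.max m%:R rho) ->
  0 < rho -> `|cusum n f om| <= `|cusum n f s| -> (dist s)%:R < rho.
Proof.
move=> d0 sn fwd bwd rho0 le_cusum; rewrite ltNge; apply/negP => rho_m.
have om1 : (0 < om)%N by case/andP: omn.
have nR : 0 < n%:R :> R by rewrite ltr0n.
set th : R := om%:R / n%:R.
have th0 : 0 < th by rewrite divr_gt0 ?ltr0n.
have th1 : th < 1 by rewrite ltr_pdivrMr// mul1r ltr_nat.
pose g : R := Num.min th (1 - th).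
have g0 : 0 < g by rewrite lt_min th0 subr_gt0.
have gth : g <= th by rewrite ge_min lexx.
have gth' : g <= 1 - th by rewrite ge_min lexx orbT.
have nd0 : 0 < `|delta| by rewrite normr_gt0.
have yE : y = g * `|delta| / 16 by [].
have y0 : 0 < y by rewrite yE divr_gt0// mulr_gt0.
have omE : om%:R = n%:R * th by rewrite /th; field; rewrite gt_eqF.
have hE : h om = n%:R * (th * (1 - th)).
  by rewrite /h subnn subr0 -/th omE mulrA.
have h0 : 0 < h om.
  by rewrite hE; apply: mulr_gt0 => //; apply: mulr_gt0 => //; rewrite subr_gt0.
set m := dist s in rho_m.
have mE1 : (s <= om)%N -> m = (om - s)%N.
  by rewrite -subn_eq0 /m /dist => /eqP ->; rewrite max0n.
have mE2 : (om <= s)%N -> m = (s - om)%N.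
  by rewrite -subn_eq0 /m /dist => /eqP ->; rewrite maxn0.
have m0 : 0 < m%:R :> R by exact: lt_le_trans rho_m.
have mn : m%:R <= n%:R :> R 
  by rewrite ler_nat geq_max !(leq_trans (leq_subr _ _))// ltnW.
have rhon : rho <= n%:R by exact: le_trans mn.
have bndn k : (k <= n)%N -> y * Num.max k%:R rho <= y * n%:R.
  by move=> kn; rewrite ler_wpM2l ?(ltW y0)// ge_max ler_nat kn.
have S_om : `|S om| <= y * n%:R.
  have S0 : S 0%N = 0 by rewrite /S big_geq.
  rewrite -(subr0 (S om)) -S0 backward_sum// subn0 (le_trans (bwd _ _))// ?bndn//;
    exact: ltnW.
have S_n : `|S n - S om| <= y * n%:R.
  rewrite forward_sum ?(ltnW omn')// (le_trans (fwd _ _))// ?bndn//; exact: leq_subr.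
have S_s : `|S s - S om| <= y * m%:R.
  have maxm : Num.max m%:R rho = m%:R by apply/max_idPl.
  rewrite -maxm; have [so|so] := leqP s om.
    rewrite mE1// -[`|_|]normrN opprB backward_sum//.
    by rewrite bwd// (leq_trans (leq_subr _ _))// ltnW.
  rewrite mE2// ?(ltnW so)// forward_sum ?(ltnW so)//.
  by rewrite fwd// (leq_trans (leq_subr _ _)).
have S_n2 : `|S n| <= 2 * y * n%:R.
  by rewrite -(subrK (S om) (S n)) (le_trans (ler_normD _ _))//; lra.
have Z_om : `|Z om| <= 3 * y * n%:R.
  rewrite /Z (le_trans (ler_normB _ _))// normrZ -/th (gtr0_norm th0).
  have : th * `|S n| <= `|S n| by rewrite ler_piMl// ltW.
  by lra.
pose c : R := if (s <= om)%N then 1 - th else th.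
have gc : g <= c by rewrite /c; case: ifP.
have hs : h om - h s = m%:R * c.
  rewrite tent_gap// /c; case: leqP => so; first by rewrite mE1.
  by rewrite mE2// ltnW.
have Z_s : `|Z s - Z om| <= 3 * y * m%:R.
  have -> : Z s - Z om = (S s - S om) - ((s%:R - om%:R) / n%:R) *: S n.
    by rewrite /Z mulrBl scalerBl !opprD !opprK addrACA.
  have dE : `|(s%:R - om%:R) / n%:R| = m%:R / n%:R :> R.
    rewrite normrM normfV (gtr0_norm nR); congr (_ / _).
    have [so|so] := leqP s om; first by rewrite mE1// distrC -natrB// normr_nat.
    by rewrite mE2 ?(ltnW so)// -natrB ?(ltnW so)// normr_nat.
  rewrite (le_trans (ler_normB _ _))// normrZ dE.
  have : m%:R / n%:R * `|S n| <= m%:R / n%:R * (2 * y * n%:R).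
    by rewrite ler_wpM2l// divr_ge0// ltW.
  rewrite (_ : _ * (2 * y * n%:R) = 2 * y * m%:R); last by field; rewrite gt_eqF.
  by move: (m%:R / n%:R * _) S_s => v; lra.
pose tau := h s / h om.
have tauE : (1 - tau) * h om = m%:R * c.
  by rewrite -hs /tau mulrBl divfK ?gt_eqF// mul1r.
have tau1 : tau <= 1.
  rewrite -subr_ge0 -(pmulr_lge0 _ h0) tauE mulr_ge0// ltW//.
  exact: lt_le_trans gc.
have tau0 : 0 <= tau.
  rewrite divr_ge0 ?(ltW h0)// /h -/th; case: (leqP s om) => so.
    rewrite (_ : s - om = 0)%N; last by apply/eqP; rewrite subn_eq0.
    by rewrite subr0 mulr_ge0// subr_ge0 ltW.
  rewrite (natrB _ (ltnW so)) omE.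
  rewrite (_ : _ - _ = th * (n%:R - s%:R)); last by ring.
  by rewrite mulr_ge0 ?(ltW th0)// subr_ge0 ler_nat.
have := cusum_drop sn h0 tau0 tau1 le_cusum; rewrite -/tau.
have gh : g * n%:R <= 2 * h om.
  rewrite hE mulrC mulrCA ler_wpM2l//.
  have [] := leP th (1 - th) => hth; nra.
move=> drop.
have c0 : 0 < c by exact: lt_le_trans gc.
have : c * (h om * `|delta| - 6 * y * n%:R) <= 3 * y * h om.
  rewrite -(ler_pM2l m0) mulrA -tauE.
  apply: (@le_trans _ _ (h om * ((1 - tau) * (h om * `|delta| - 2 * `|Z om|)))).
    rewrite [leRHS]mulrA [h om * (1 - tau)]mulrC ler_wpM2l//; last by lra.
    by rewrite mulr_ge0 ?(ltW h0)// subr_ge0.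
  apply: (@le_trans _ _ (h om * (3 * y * m%:R))).
    by rewrite ler_wpM2l ?(ltW h0)// (le_trans drop).
  by rewrite le_eqVlt; apply/orP; left; apply/eqP; ring.
apply/negP; rewrite -ltNge yE.
move: (h om) (`|delta|) (n%:R) h0 nd0 gh gc g0 c0 => H D N H0 D0 gN gc g0 c0.
rewrite -subr_gt0.
have -> : c * (H * D - 6 * (g * D / 16) * N) - 3 * (g * D / 16) * H =
    D * (c * (2 * H - g * N) * 6 + H * (c - g) * 3 + c * H) / 16 by field.
rewrite divr_gt0// mulr_gt0// ltr_wpDl// ?mulr_gt0//.
by rewrite addr_ge0// mulr_ge0// mulr_ge0 ?subr_ge0// ltW.
Qed.

End Deterministic.

(** * Union bound over the coordinates *)

Section Coordinates.
Context d (Om : measurableType d) (R : realType) (P : probability Om R)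
  (K : nat) (H : 'I_K -> hilbertType R).

Lemma coordinate_continuous (k : 'I_K) :
  continuous ((fun x => x k) : dsum H -> H k).
Proof. exact: proj_continuous. Qed.

Lemma random_coordinate (X : Om -> dsum H) (k : 'I_K) :
  random_element X -> random_element (fun w => X w k).
Proof.
by move=> mX B mB; exact: (mX _ (borel_preimage (@coordinate_continuous k) mB)).
Qed.

Lemma same_law_coordinate (X Y : Om -> dsum H) (k : 'I_K) :
  same_law P X Y -> same_law P (fun w => X w k) (fun w => Y w k).
Proof.
by move=> XY B mB; exact: (XY _ (borel_preimage (@coordinate_continuous k) mB)).
Qed.

End Coordinates.

Section Tails.
Context {R : realType}.

(** The exponent of [maximal_inequality] is quadratic over linear in [nu], just
    like the inverse of [nu ^- 2 + nu^-1], so their product is bounded below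
    uniformly in [nu]. *)
Lemma rate_lower_bound (al nu L : R) : 0 < al -> 0 < nu -> 0 <= L ->
  4 * L <= (al * nu) ^+ 2 / (4 * (1 + al * nu))
           * (16 * (1 + al) / al ^+ 2 * L * (nu ^- 2 + nu^-1)).
Proof.
move=> al0 nu0 L0.
have an0 : 0 < al * nu by rewrite mulr_gt0.
rewrite (_ : _ / _ * _ = 4 * L * ((1 + al) * (1 + nu) / (1 + al * nu))); last first.
  by field; rewrite !gt_eqF//; lra.
rewrite ler_peMr ?mulr_ge0// ler_pdivlMr ?mul1r; nra.
Qed.

Lemma expR1_ge2 : 2 <= expR 1 :> R.
Proof. by have := expR_ge1Dx (1 : R); lra. Qed.

(** One factor [expR (- L)] equals [eta / (expR 1 * c)], which pays for the [c]
    coordinates; the other three pay for the constant 8. *)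
Lemma union_budget (c : nat) (eta : R) (L := ln (expR 1 * c%:R / eta)) :
  (0 < c)%N -> 0 < eta < 1 ->
  [/\ 1 <= L, expR (- (4 * L)) <= 2^-1 &
      c%:R * (4 * expR (- (4 * L)) + 4 * expR (- (4 * L))) <= eta].
Proof.
move=> c0 /andP[e0 e1].
have c1 : 1 <= c%:R :> R by rewrite ler1n.
have ec0 : 0 < expR 1 * c%:R / eta :> R.
  by rewrite divr_gt0// mulr_gt0 ?expR_gt0//; lra.
have EL : expR L = expR 1 * c%:R / eta by rewrite lnK.
have L1 : 1 <= L.
  rewrite -ler_expR EL ler_pdivlMr// ler_wpM2l ?expR_ge0//; lra.
have e2 : expR (- L) <= 2^-1.
  rewrite expRN lef_pV2 ?posrE ?expR_gt0//.
  by rewrite (le_trans expR1_ge2)// ler_expR.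
have E4 : expR (- (4 * L)) = expR (- L) ^+ 4.
  by rewrite -mulrN -expRM_natl.
have x0 := expR_ge0 (- L).
have x3 : expR (- L) ^+ 3 <= 8^-1.
  rewrite (_ : 8^-1 = 2^-1 ^+ 3); last by field.
  by rewrite lerXn2r ?nnegrE.
have E0 : c%:R * expR (- L) = eta / expR 1.
  by rewrite expRN EL invf_div; field; rewrite gt_eqF ?expR_gt0//; lra.
split => //.
  by rewrite E4 exprSr; have := exprn_ge0 3 x0; nra.
rewrite E4 exprS -mulrDl (_ : _ * _ = 8 * (eta / expR 1) * expR (- L) ^+ 3); last first.
  by rewrite -E0; ring.
have ee : eta / expR 1 <= eta.
  by rewrite ler_pdivrMr ?expR_gt0// ler_peMr//; have := expR1_ge2; lra.
have e8 : 0 <= eta / expR 1 by rewrite divr_ge0 ?expR_ge0// ltW.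
by have := exprn_ge0 3 x0; nra.
Qed.

End Tails.

Lemma probability_bigcup_le d (Om : measurableType d) (R : realType)
    (P : probability Om R) (I : Type) (s : seq I) (F : I -> set Om) :
  (forall i, measurable (F i)) ->
  (P (\big[setU/set0]_(i <- s) F i) <= \sum_(i <- s) P (F i))%E.
Proof.
move=> mF; elim: s => [|i s IH]; first by rewrite !big_nil measure0.
rewrite !big_cons (le_trans (measureU2 _ _ _))//; last by rewrite leeD2l.
exact: bigsetU_measurable.
Qed.

Lemma normz_subn (a b : nat) : `|a%:Z - b%:Z| = (maxn (a - b) (b - a))%N%:Z.
Proof. lia. Qed.

Theorem theorem3p5 (R : realType) (CA DR : R) (hCA : 0 < CA) (hDR : 0 < DR) :
  exists C : R,
  forall (d : measure_display) (Om : measurableType d) (P : probability Om R)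
    (n K : nat) (H : 'I_K -> hilbertType R)
    (mu delta : forall k, H k) (omega : 'I_K -> nat)
    (eps : int -> Om -> dsum H),
    (2 <= n)%N -> (0 < K)%N ->
    (forall k, separable (H k)) ->
    (forall k, (1 <= omega k <= n - 1)%N) ->
    stationary_noise P eps ->
    assumption_B P CA DR eps ->
  forall kappa : {set 'I_K},
    kappa != finset.set0 -> kappa \subset change_set delta ->
  forall eta : R, 0 < eta < 1 ->
    ((1 - eta)%:E <=
     P [set w | forall k, k \in kappa ->
         (`|(omega_hat n (observation mu delta omega eps k w))%:Z
            - (omega k)%:Z| < conf_radius n delta omega C eta kappa k)%R])%E.
Proof.
(* [al * nu] is the threshold [nu / 16] in units of [CA * (2 * DR)]. *)
pose al := (32 * CA * DR)^-1; pose C := 16 * (1 + al) / al ^+ 2.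
exists C => d Om P n K H mu delta omega eps n2 K0 sepH omn [mEps _ _].
move=> [A [eta [[_ sumA] [mEta [indEta lawEta]] cEta psiEta epsE]]].
move=> kappa kappa0 kappa_delta eta' eta01.
have al0 : 0 < al by rewrite invr_gt0 !mulr_gt0.
have card0 : (0 < #|kappa|)%N by rewrite card_gt0.
have [] := union_budget card0 eta01.
set L := ln _ => L1 q2 budget.
have n0 : (0 < n)%N := leq_trans (ltn0Sn 1) n2.
pose nu_ k := nu n delta omega k; pose y k := nu_ k / 16.
pose rho k := C * L * (nu_ k ^- 2 + (nu_ k)^-1).
pose sgf k (i : nat) : int := (omega k).+1%:Z + i%:Z.
pose sgb k (i : nat) : int := (omega k)%:Z - i%:Z.
pose bad (sg : 'I_K -> nat -> int) k := [set w | exists2 m, (m <= n)%N &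
  y k * Num.max m%:R (rho k) < `|\sum_(0 <= i < m) (eps (sg k i) w k : H k)|].
have nu0 k : k \in kappa -> 0 < nu_ k.
  move=> /(fintype.subsetP kappa_delta); rewrite inE => dk.
  have /andP[om1 omn1] := omn k.
  have nR : 0 < n%:R :> R by rewrite ltr0n.
  have omn2 : (omega k < n)%N by rewrite (leq_ltn_trans omn1)// subn1 ltn_predL.
  rewrite /nu_ /nu; apply: mulr_gt0; last by rewrite normr_gt0.
  rewrite lt_min; apply/andP; split; first by rewrite divr_gt0 ?ltr0n.
  by rewrite subr_gt0 ltr_pdivrMr// mul1r ltr_nat.
have C0 : 0 < C by rewrite divr_gt0 ?exprn_gt0// mulr_gt0//; lra.
have rho0 k : k \in kappa -> 0 < rho k.
  move=> kk; apply: mulr_gt0; first by apply: mulr_gt0 => //; lra.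
  by apply: addr_gt0; rewrite invr_gt0 ?exprn_gt0// nu0.
have mbad sg k : measurable (bad sg k).
  apply: measurable_exceeds => m; apply: measurable_norm_random.
  apply: (random_element_sum (sepH k)) => i _.
  exact: random_coordinate (mEps _).
have mGood k (Q : set nat) :
    measurable [set w | Q (omega_hat n (observation mu delta omega eps k w))].
  apply: measurable_omega_hat (sepH k) _ => i; apply: (random_elementD (sepH k)).
    exact: random_element_cst.
  exact: random_coordinate (mEps _).
have Pbad sg (sg' : 'I_K -> int -> nat) k : cancel (sg k) (sg' k) ->
    k \in kappa -> (P (bad sg k) <= (4 * expR (- (4 * L)))%:E)%E.
  move=> sgK kk.
  have D0 : 0 < 2 * DR by rewrite mulr_gt0.
  have mEtak i : random_element (fun w => eta i w k) by exact: random_coordinate.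
  have psik i : ('E_P[(fun w => expR (`|eta i w k| / (2 * DR)) - 1)%R] <= 1)%E.
    have := psi1_norm_exp_moment (measurable_norm_random (mEtak 0)) hDR (psiEta k).
    under [X in ('E_P[X] <= _ -> _)%E]eq_fun do rewrite normr_id.
    rewrite unlock.
    rewrite (@same_law_integral _ _ _ P (H k) (fun w => eta 0 w k)
      (fun w => eta i w k) (fun x => (expR (`|x| / (2 * DR)) - 1)%:E)) //.
    - exact: same_law_coordinate.
    - apply/measurable_EFinP; apply: measurable_funB => //.
      apply: measurableT_comp => //; apply: measurable_funM => //.
      exact: norm_borel_measurable.
    - move=> x; rewrite lee_fin subr_ge0 -[leLHS]expR0 ler_expR.
      by rewrite divr_ge0// ltW.
  have y0 : 0 < y k by rewrite divr_gt0// nu0.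
  have uE : y k / (CA * (2 * DR)) = al * nu_ k.
    by rewrite /y /al; field; rewrite !gt_eqF.
  have rate := rate_lower_bound al0 (nu0 k kk) (le_trans ler01 L1).
  have tail : expR (- ((y k / (CA * (2 * DR))) ^+ 2 /
      (4 * (1 + y k / (CA * (2 * DR)))) * rho k)) <= expR (- (4 * L)).
    by rewrite ler_expR lerN2 uE.
  have := @linear_process_maximal _ _ _ P (H k) (sepH k) (A k)
    (fun i w => eta i w k) (fun i w => eps i w k) CA (2 * DR) hCA D0 (sumA k)
    mEtak (independent_comp (@coordinate_continuous _ _ H k) indEta)
    (fun i => cEta i k) psik (fun i => random_coordinate (mEps i)) (epsE k)
    (sg k) (sg' k) (y k) (rho k) n sgK y0 (ltW (rho0 k kk)) (le_trans tail q2).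
  by move=> /le_trans; apply; rewrite lee_fin ler_pM2l.
set good := [set w | _].
pose B k := bad sgf k `|` bad sgb k.
have mB k : measurable (B k) by exact: measurableU.
have mgood : measurable good.
  rewrite (_ : good = \bigcap_(k in [set k | k \in kappa]) [set w |
      [set s : nat | `|s%:Z - (omega k)%:Z| < conf_radius n delta omega C eta' kappa k]
      (omega_hat n (observation mu delta omega eps k w))]).
    by apply: fin_bigcap_measurable.
  by apply/seteqP; split.
(* Off the bad events, [argmax_close] applies to the maximizer. *)
have sub : ~` good `<=` \big[setU/set0]_(k <- enum kappa) B k.
  move=> w nw; apply: contrapT => nB; apply: nw => k kk.
  have nb : ~ B k w.
    by move=> Bw; apply: nB; rewrite -bigcup_seq; exists k => //=; rewrite mem_enum.
  have below (sg : 'I_K -> nat -> int) : ~ bad sg k w -> forall m, (m <= n)%N ->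
      `|\sum_(0 <= i < m) (eps (sg k i) w k : H k)| <= y k * Num.max m%:R (rho k).
    by move=> h m mn; rewrite leNgt; apply/negP => lt_m; apply: h; exists m.
  have [hat_n hat_max] := omega_hat_argmax
    (observation mu delta omega eps k w) n0.
  set s := omega_hat _ _ in hat_n hat_max *.
  have dk : delta k != 0.
    by move/(fintype.subsetP kappa_delta) : kk; rewrite inE.
  have om_n : (1 <= omega k <= n)%N.
    by case/andP: (omn k) => -> /= /leq_trans; apply; exact: leq_subr.
  have := argmax_close (e := fun i => eps i w k) (mu := mu k) (omn k) dk
    (proj2 (andP hat_n)) (below sgf _) (below sgb _) (rho0 k kk) (hat_max _ om_n).
  move=> /(_ (fun h => nb (or_introl h)) (fun h => nb (or_intror h))) close.
  rewrite /conf_radius ceil_gt_int; apply: le_lt_trans close.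
  rewrite le_eqVlt; apply/orP; left; apply/eqP.
  by rewrite normz_subn pmulrn.
have PB : (P (~` good) <= eta'%:E)%E.
  apply: (@le_trans _ _ (P (\big[setU/set0]_(k <- enum kappa) B k))).
    by apply: le_measure sub; rewrite inE; [exact: measurableC|exact: bigsetU_measurable].
  rewrite (le_trans (probability_bigcup_le _ _ _))//.
  apply: (@le_trans _ _ (\sum_(k <- enum kappa)
      (4 * expR (- (4 * L)) + 4 * expR (- (4 * L)))%:E)%E).
    rewrite big_seq [leRHS]big_seq; apply: lee_sum => k; rewrite mem_enum => kk.
    rewrite (le_trans (measureU2 _ _ _))// EFinD leeD//.
      apply: (Pbad _ (fun k z => `|z - (omega k).+1%:Z|%N)) => // i.
      by rewrite /sgf /= addrC addKr.
    apply: (Pbad _ (fun k z => `|(omega k)%:Z - z|%N)) => // i.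
    by rewrite /sgb /= opprB addrC subrK.
  rewrite sumEFin lee_fin; apply: le_trans budget.
  by rewrite big_const_seq count_predT -cardE iter_addr_0 -[leLHS]mulr_natl.
rewrite -(setCK good) probability_setC; last exact: measurableC.
by rewrite EFinB leeB.
Qed.
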